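(* Let $2\le a\le b$ be integers and let $\mathfrak T$ be a tree in the class $\Upsilon_{a,b}$. Set $\tau:=\log_a b$. Let $\mathcal M$ be the centred Hardy--Littlewood maximal operator on $\mathfrak T$. The following hold: (i) if $a\le b\le a^2$, then $\mathcal M$ is of restricted weak type $(\tau,\tau)$ and it is bounded on $L^p(\mathfrak T)$ for every $p\in(\tau,\infty]$; (ii) if there exist positive constants $\alpha$ and $C$ such that $|B_r(x)|\ge C\,\alpha^r$ for all vertices $x$ of $\mathfrak T$ and all nonnegative integers $r$, and $b\le \alpha^2$, then $\mathcal M$ is of restricted weak type $(p_{\alpha,b},p_{\alpha,b})$, where $p_{\alpha,b}:=\log_\alpha b$, and it is bounded on $L^p(\mathfrak T)$ for every $p\in(p_{\alpha,b},\infty]$.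
   Context: A tree is a connected graph with no loops (cycles), identified with its set of vertices; $\nu(x)$ is the number of neighbours of the vertex $x$. For integers $a\le b$, $\Upsilon_{a,b}$ is the class of all trees such that $a+1\le\nu(x)\le b+1$ for every vertex $x$, with both values $a+1$ and $b+1$ attained. A tree carries the graph distance $d$ and the counting measure $\mu$; $|E|:=\mu(E)$, and $B_r(x):=\{y: d(x,y)\le r\}$. With $\mathbb N=\{0,1,2,\dots\}$, $$\mathcal M f(x):=\sup_{r\in\mathbb N}\frac1{|B_r(x)|}\int_{B_r(x)}|f|\,d\mu .$$ Lebesgue and Lorentz spaces are with respect to the counting measure. Putting $E_f(\lambda):=\{x:|f(x)|>\lambda\}$, the Lorentz (quasi-)norms are $\|f\|_{L^{p,q}}=\big(p\int_0^\infty |E_f(\lambda)|^{q/p}\lambda^{q-1}\,d\lambda\big)^{1/q}$ for $1\le q<\infty$ and $\|f\|_{L^{p,\infty}}=\sup_{\lambda>0}\lambda|E_f(\lambda)|^{1/p}$. An operator is of restricted weak type $(p,p)$ if it is bounded from $L^{p,1}$ to $L^{p,\infty}$; for $p=1$ this means bounded from $L^{1}=L^{1,1}$ to $L^{1,\infty}$ (weak type $(1,1)$). *)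

(* Defs.v *)
From HB Require Import structures.
From mathcomp Require Export all_boot all_order all_algebra finmap.
From mathcomp Require Export all_classical all_reals all_analysis.
Set Implicit Arguments.
Unset Strict Implicit.
Unset Printing Implicit Defensive.
Import Order.TTheory GRing.Theory Num.Theory.
Local Open Scope classical_set_scope.
Local Open Scope ring_scope.

(* The base point of [vertex] plays no role: it only records that a tree is
   nonempty, as the measurable types of the library require. *)
Record tree := Tree {
  vertex : pointedType;
  adj : rel vertex;
  adj_sym : symmetric adj;
  adj_irr : irreflexive adj;
  adj_connected : forall x y, exists p, path adj x p /\ last x p = y;
  adj_acyclic : forall c, (2 < size c)%N -> uniq c -> ~~ cycle adj c
}.

Definition tree_sort (T : tree) : Type := vertex T.
Coercion tree_sort : tree >-> Sortclass.

(* Every set of vertices is measurable. *)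
HB.instance Definition _ (T : tree) := Pointed.copy (tree_sort T) (vertex T).
HB.instance Definition _ (T : tree) :=
  @isMeasurable.Build default_measure_display (tree_sort T)
    discrete_measurable discrete_measurable0
    discrete_measurableC discrete_measurableU.

Section graph.
Variable T : tree.
Implicit Types x y : T.

Definition neighbours x : set T := [set y | adj x y].

Definition nu x : nat := #|` fset_set (neighbours x)|.

Definition walk_of_length x y (n : nat) : bool :=
  `[< exists p : seq T, [/\ path (@adj T) x p, last x p = y & size p = n] >].

Lemma walk_exists x y : exists n, walk_of_length x y n.
Proof.
have [p [xp py]] := adj_connected x y.
by exists (size p); apply/asboolP; exists p.
Qed.

Definition dist x y : nat := ex_minn (walk_exists x y).

Definition tball x (r : nat) : set T := [set y | (dist x y <= r)%N].

(* [fset_set] is empty on infinite sets, hence the explicit finiteness. *)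
Definition Upsilon (a b : nat) : Prop :=
  [/\ forall x, finite_set (neighbours x) /\ (a.+1 <= nu x <= b.+1)%N,
      exists x, nu x = a.+1
    & exists x, nu x = b.+1].

End graph.

Section operators.
Context {R : realType} {T : tree}.
Local Open Scope ereal_scope.

Local Notation mu := (@counting T R).

Definition maximal (f : T -> R) (x : T) : \bar R :=
  ereal_sup [set (mu (tball x r))^-1 * \int[mu]_(y in tball x r) `|f y|%:E
            | r in [set: nat]].

(* The value at [q = -oo] is junk. *)
Definition Lorentz (p : R) (q : \bar R) (f : T -> \bar R) : \bar R :=
  let E (t : R) := [set x : T | t%:E < `|f x|] in
  match q with
  | q'%:E =>
      (p%:E * \int[lebesgue_measure]_(t in `]0%R, +oo[)
                (mu (E t) `^ (q' / p) * (t `^ (q' - 1))%:E)) `^ q'^-1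
  | +oo => ereal_sup [set t%:E * mu (E t) `^ p^-1 | t in `]0%R, +oo[]
  | -oo => 0
  end.

Definition restricted_weak_type (S : (T -> R) -> T -> \bar R) (p : R) : Prop :=
  exists2 K : R, (0 < K)%R &
    forall f : T -> R, Lorentz p 1 (EFin \o f) < +oo ->
      Lorentz p +oo (S f) <= K%:E * Lorentz p 1 (EFin \o f).

Definition bounded_on_L (S : (T -> R) -> T -> \bar R) (p : \bar R) : Prop :=
  exists2 K : R, (0 < K)%R &
    forall f : T -> R, 'N[mu]_p[EFin \o f] < +oo ->
      'N[mu]_p[S f] <= K%:E * 'N[mu]_p[EFin \o f].

End operators.

Definition log {R : realType} (c x : R) : R := ln x / ln c.

(* Main.v *)
Require Import Defs.
From mathcomp Require Import ess_sup_inf measurable_realfun lebesgue_measure.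
From mathcomp Require Import zify ring lra.
(** Why the theorem holds. Part (i) is part (ii) with [alpha = a] and [C = 1],
    since every sphere of radius [r] has at least [a ^ r] points. In part (ii)
    put [p = log alpha b]. Balls have at most [4 * b ^ r] points, so
    [alpha <= b] ([alpha_le_b]), and [1 <= p <= 2]. Since [1 < alpha], a large
    average over a ball forces a large sum over one of the spheres inside it
    ([ball_average_sphere]), so that the operators to control are
    [alpha ^- k * \sum_(d(x, y) = k) f y].

    Fix a root. Two vertices at distance [k] have [anc i x = anc j y] for some
    [i + j = k] ([confluence]), and a vertex has at most [2 * b ^ i] descendants
    [i] levels below it ([count_desc]).

    If [p = 1], that is [alpha = b], one ignores the coupling [i + j = k]. For
    fixed [j] the supremum over [i] of [b ^- i] times the sum of [f] over the
    descendants of [anc i x] at depth [j] is of weak type (1,1) with a constant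
    independent of [j] ([cone_apex_bound]), and the remaining factor [b ^- j] is
    summable.

    If [1 < p], take [f] to be the indicator of a finite set [E] and sum along
    the diagonals [i - j = m]. There [alpha ^- (i + j)] is at most [b ^- n],
    with [n = minn i j], times [alpha ^- `|m|], because [b <= alpha ^+ 2]. What
    is left are averages over families of nested cones, and the maximal
    function of a nested family is of weak type (1,1) ([cone_maximal_bound]). With
    [beta = b / alpha = alpha `^ (p - 1)], the diagonals [i <= j] contribute
    [alpha ^- m * #|E| / lam]. A diagonal [i - j = m] contributes
    [beta ^+ m * #|E| / lam], but its sum never exceeds [2 * alpha ^- m], so
    only those with [alpha ^+ m] at most of order [1 / lam] matter, and
    [beta ^+ m] is then at most of order [lam `^ (1 - p)]. In total the
    superlevel set has at most [K * lam `^ (- p) * #|E|] points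
    ([weak_on_sets_gt1]).

    This estimate for sets gives everything else. For [1 < p] it implies
    [\sum_(x in X) M 1_E x <= K * #|E| `^ (1 / p) * #|X| `^ (1 - 1 / p)]
    ([restricted_bilinear]), which is linear in [E] once the radii are chosen;
    integrating over the superlevel sets of [f] bounds [L^{p,1}] into
    [L^{p,oo}]. For exponents larger than [p] a dyadic decomposition
    interpolates between the estimate for sets and the trivial bound on
    [L^oo] ([strong_of_weak_on_sets]). *)

Set Implicit Arguments.
Unset Strict Implicit.
Unset Printing Implicit Defensive.
Import Order.TTheory GRing.Theory Num.Theory.
Local Open Scope classical_set_scope.
Local Open Scope ring_scope.

(** * Distance, levels and ancestors *)

Section Distance.
Local Open Scope nat_scope.
Variable T : tree.
Implicit Types x y z : T.

Definition walk x y n :=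
  exists p : seq T, [/\ path (@adj T) x p, last x p = y & size p = n].

Lemma walk_dist x y : walk x y (dist x y).
Proof. by rewrite /dist; case: ex_minnP => n /asboolP. Qed.

Lemma dist_le_walk x y n : walk x y n -> dist x y <= n.
Proof. by move=> w; rewrite /dist; case: ex_minnP => m _; apply; apply/asboolP. Qed.

Lemma walk_trans y x z m n : walk x y m -> walk y z n -> walk x z (m + n).
Proof.
move=> [p [xp <- <-]] [q [yq qz <-]]; exists (p ++ q).
by rewrite cat_path xp yq last_cat size_cat.
Qed.

Lemma walk_sym x y n : walk x y n -> walk y x n.
Proof.
move=> [p [xp <- <-]]; exists (rev (belast x p)); split.
- by rewrite rev_path; apply: sub_path xp => u v; rewrite adj_sym.
- by case: p {xp} => //= a p; rewrite rev_cons last_rcons.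
- by rewrite size_rev size_belast.
Qed.

Lemma dist_sym x y : dist x y = dist y x.
Proof.
by apply/eqP; rewrite eqn_leq !dist_le_walk //; apply/walk_sym/walk_dist.
Qed.

Lemma dist_triangle y x z : dist x z <= dist x y + dist y z.
Proof. by apply: dist_le_walk; apply: walk_trans (walk_dist _ _) (walk_dist _ _). Qed.

Lemma distxx x : dist x x = 0.
Proof. by apply/eqP; rewrite -leqn0; apply: dist_le_walk; exists [::]. Qed.

Lemma dist_eq0 x y : dist x y = 0 -> x = y.
Proof. move=> d0; by have := walk_dist x y; rewrite d0 => -[[|a p] [_ <-]]. Qed.

Lemma dist_adj x y : adj x y -> dist x y <= 1.
Proof. by move=> xy; apply: dist_le_walk; exists [:: y]; rewrite /= xy. Qed.

End Distance.

Section Rooted.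
Local Open Scope nat_scope.
Variables (T : tree) (o : T).
Implicit Types x y z : T.

Definition lev x := dist o x.

Lemma parent_exists x : 0 < lev x -> exists z, adj z x /\ lev z = (lev x).-1.
Proof.
rewrite /lev => x0; have [p [op px sp]] := walk_dist o x.
case/lastP: p => [|p z] in op px sp *; first by rewrite -sp in x0.
move: op px sp; rewrite rcons_path last_rcons size_rcons => /andP[op pz] zx sp.
rewrite -sp /=; rewrite zx in pz; exists (last o p); split => //.
have le1 : dist o (last o p) <= size p by apply: dist_le_walk; exists p.
have := leq_trans (dist_triangle (last o p) o x) (leq_add (leqnn _) (dist_adj pz)).
by rewrite -sp; lia.
Qed.

(** The root is its own parent, so that [anc] is total; statements about
    ancestors therefore carry a bound on the level. *)
Definition par x : T :=
  if lev x == 0 then x else xget x [set z | adj z x /\ lev z = (lev x).-1].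

Lemma par_spec x : 0 < lev x -> adj (par x) x /\ lev (par x) = (lev x).-1.
Proof.
rewrite /par lt0n => x0; rewrite (negPf x0); case: xgetP => //= H.
by have [|z ?] := @parent_exists x; [rewrite lt0n | have := H z].
Qed.

Lemma adj_par x : 0 < lev x -> adj (par x) x.
Proof. by case/par_spec. Qed.

Lemma lev_par x : lev (par x) = (lev x).-1.
Proof.
case: (posnP (lev x)) => [x0|/par_spec[]//]; by rewrite /par x0.
Qed.

Definition anc i x := iter i par x.

Lemma ancS i x : anc i.+1 x = anc i (par x).
Proof. by rewrite /anc iterSr. Qed.

Lemma ancD i j x : anc (i + j) x = anc i (anc j x).
Proof. by rewrite /anc iterD. Qed.

Lemma lev_anc i x : lev (anc i x) = lev x - i.
Proof.
by elim: i => [|i IH]; rewrite ?subn0 //= lev_par IH; lia.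
Qed.

Lemma lev_eq0 x : lev x = 0 -> x = o.
Proof. by move/dist_eq0. Qed.

Lemma anc_lev x : anc (lev x) x = o.
Proof. by apply: lev_eq0; rewrite lev_anc subnn. Qed.

Lemma uniq_ancestors n x : n <= (lev x).+1 -> uniq (traject par x n).
Proof.
move=> nx; apply: (@map_uniq _ _ lev).
have -> : [seq lev i | i <- traject par x n] = [seq lev x - i | i <- iota 0 n].
  apply: (@eq_from_nth _ 0); first by rewrite !size_map size_traject size_iota.
  move=> i; rewrite size_map size_traject => i_n.
  rewrite (nth_map x) ?size_traject// nth_traject// (nth_map 0) ?size_iota//.
  by rewrite nth_iota// -/(anc i x) lev_anc.
rewrite map_inj_in_uniq ?iota_uniq// => i j; rewrite !mem_iota !add0n /=; lia.
Qed.

Lemma path_ancestors n x : n <= lev x ->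
  path (@adj T) x (traject par (par x) n).
Proof.
elim: n x => //= n IH x nx; rewrite adj_sym adj_par ?(leq_trans _ nx)//.
by apply: IH; rewrite lev_par; lia.
Qed.

(** Otherwise the chains of ancestors of [x] and of [y], each cut at their first
    common vertex, close up with the edge between [x] and [y] to a cycle. *)
Lemma adj_parent x y : adj x y ->
  (0 < lev x /\ y = par x) \/ (0 < lev y /\ x = par y).
Proof.
move=> xy; have [/orP[/andP[? /eqP]|/andP[? /eqP]]|] :=
  boolP ((0 < lev x) && (y == par x) || (0 < lev y) && (x == par y)).
- by left.
- by right.
rewrite negb_or !negb_and => /andP[yNx xNy].
have xDy : x != y by apply: contraTneq xy => ->; rewrite adj_irr.
pose meet i := [exists j : 'I_(lev y).+1, (i <= lev x) && (anc i x == anc j y)].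
have ex_meet : exists i, meet i.
  by exists (lev x); apply/existsP; exists ord_max; rewrite leqnn !anc_lev /=.
have [i /existsP[[j jy] /= /andP[ix /eqP ij]] i_min] := ex_minnP ex_meet.
rewrite ltnS in jy.
(* The cycle: up from x to the meeting vertex, then down to y. *)
pose c := traject par x i.+1 ++ rev (traject par y j).
have lt2 : 2 < size c.
  rewrite size_cat size_rev !size_traject.
  case: i ij ix {i_min c} => [|[|i]]; case: j jy => [|[|j]] //=; rewrite ?addn0 //.
  - by move=> _ xy0; rewrite xy0 eqxx in xDy.
  - by move=> y0 xE; rewrite xE eqxx y0 in xNy.
  - by move=> _ yE x0; rewrite -yE eqxx x0 in yNx.
have beq : belast y (traject par (par y) j) = traject par y j.
  by elim: (j) (y) => //= k IH z; rewrite IH.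
have leq : last y (traject par (par y) j) = anc j y.
  by rewrite last_traject.
suff uniq_c : uniq c.
  case: (elimN idP (adj_acyclic lt2 uniq_c)).
  rewrite /c /= rcons_cat cat_path path_ancestors//= last_traject -/(anc i x) ij.
  rewrite rcons_path -beq -leq rev_path; apply/andP; split.
    by apply: sub_path (path_ancestors jy) => u v; rewrite adj_sym.
  case: (j) => [|k] /=; first by rewrite adj_sym.
  by rewrite rev_cons last_rcons adj_sym.
rewrite cat_uniq rev_uniq uniq_ancestors ?ltnS// uniq_ancestors ?(leqW jy)// andbT /=.
apply/hasPn => z; rewrite mem_rev => /trajectP[b bj ->].
rewrite -[_ \in _]/(_ \in traject par x i.+1).
apply/negP => /trajectP[a]; rewrite ltnS => ai /esym eab.
have le_ia : i <= a.
  apply: i_min; apply/existsP.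
  have b_lt : b < (lev y).+1 by lia.
  by exists (Ordinal b_lt); rewrite (leq_trans ai ix) /=; apply/eqP.
have ea : a = i by lia.
have := congr1 lev eab; rewrite -/(anc a x) -/(anc b y) ea ij !lev_anc; lia.
Qed.

Lemma dist_anc i x : dist x (anc i x) <= i.
Proof.
elim: i => [|i IH]; first by rewrite distxx.
rewrite /= -/(anc i x) (leq_trans (dist_triangle (anc i x) _ _))//.
rewrite -(addn1 i) leq_add//.
case: (posnP (lev (anc i x))) => [/eqP e|e]; last by rewrite dist_sym dist_adj ?adj_par.
by rewrite /par e distxx.
Qed.

(** Prepending an edge to a path from [x'] to [y] moves the first endpoint to a
    parent or to a child. If it moves to a child, the common ancestor is kept and
    is one level further up; if it moves to the parent, the common ancestor is kept
    when it is a proper ancestor of [x'], and is replaced by its own parent when it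
    is [x'] itself. *)
Lemma confluence x y : exists i j,
  [/\ i + j = dist x y, i <= lev x, j <= lev y & anc i x = anc j y].
Proof.
have [p [xp py sp]] := walk_dist x y.
suff [i [j [ij ix jy e]]] : exists i j,
    [/\ i + j <= size p, i <= lev x, j <= lev y & anc i x = anc j y].
  exists i, j; split => //; apply/eqP; rewrite eqn_leq -{1}sp ij /=.
  rewrite (leq_trans (dist_triangle (anc i x) _ _))// leq_add ?dist_anc//.
  by rewrite e dist_sym dist_anc.
elim: p x xp py {sp} => [x _ <-|x' p IH x /= /andP[xx' xp] py].
  by exists 0, 0.
have [i [j [ij ix jy e]]] := IH _ xp py.
have [[x0 ex]|[x0 ex]] := adj_parent xx'.
  exists i.+1, j; rewrite ancS -ex e; split => //; move: ix; rewrite ex lev_par; lia.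
case: i => [|i] in ij ix e *.
  (* Here x' is itself the common ancestor. *)
  exists 0, j.+1; have /= := lev_anc j y; rewrite -e /= => levx'.
  by split => //; lia.
exists i, j; rewrite ex -ancS e lev_par; split => //; lia.
Qed.

End Rooted.

(** * Number of descendants, size of spheres and balls *)

Section Growth.
Local Open Scope fset_scope.
Local Open Scope nat_scope.
Variables (T : tree) (o : T).
Hypothesis finite_neighbours : forall x : T, finite_set (neighbours x).
Implicit Types (x y z : T) (F : {fset T}).

Definition child z : set T := [set y | adj z y /\ lev o y = (lev o z).+1].
Definition children z : {fset T} := fset_set (child z).

Lemma finite_child z : finite_set (child z).
Proof. by apply: sub_finite_set (finite_neighbours z) => y []. Qed.

Lemma childrenP z y :
  reflect (0 < lev o y /\ par o y = z) (y \in children z).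
Proof.
rewrite /children in_fset_set ?inE; last exact: finite_child.
apply: (iffP (asboolP _)) => [[zy levy]|[y0 <-]]; last first.
  by split; [exact: adj_par | rewrite lev_par prednK].
have [[z0 ey]|[y0 ->//]] := adj_parent o zy.
by move: levy; rewrite ey lev_par; lia.
Qed.

Lemma card_children_le b z : nu z <= b.+1 -> #|` children z| <= b.+1.
Proof.
apply: leq_trans; apply: fsubset_leq_card; rewrite -fset_set_sub//; first by move=> y [].
exact: finite_child.
Qed.

Lemma card_children_lt b z : nu z <= b.+1 -> 0 < lev o z -> #|` children z| <= b.
Proof.
move=> nub z0; rewrite -ltnS (leq_trans _ nub)// /nu.
rewrite [leqRHS](cardfsD1 (par o z)) in_fset_set//.
have -> : par o z \in neighbours z by apply/mem_set; rewrite /neighbours /= adj_sym adj_par.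
rewrite add1n ltnS; apply/fsubset_leq_card/fsubsetP => y yz.
have /childrenP[y0 pyz] := yz.
rewrite in_fsetD1 in_fset_set// andbC; apply/andP; split.
  by apply/mem_set; rewrite /neighbours /= -pyz adj_par.
apply/eqP => e; have := congr1 (lev o) e.
by rewrite lev_par -pyz lev_par; lia.
Qed.

Lemma card_children_ge a z : a.+1 <= nu z -> a <= #|` children z|.
Proof.
move=> nua; rewrite -ltnS (leq_trans nua)// /nu.
apply: (@leq_trans #|` par o z |` children z|); last first.
  by rewrite cardfsU1; case: (_ \notin _) => //=; rewrite ?add0n ?leqW.
apply/fsubset_leq_card/fsubsetP => y; rewrite in_fset_set// => /set_mem zy.
rewrite in_fset1U; have [[z0 ->]|[y0 ezy]] := adj_parent o zy; first by rewrite eqxx.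
by apply/orP; right; apply/childrenP.
Qed.

(** The condition on the level excludes the root from being counted as its own
    descendant. *)
Definition desc i z x := (i <= lev o x) && (anc o i x == z).

Lemma desc_step i z x :
  desc i.+1 z x <= \sum_(c <- children z) desc i c x.
Proof.
case: (boolP (desc i.+1 z x)) => // /andP[ix /eqP iz].
have cz : anc o i x \in children z.
  apply/childrenP; split; last by rewrite -iz.
  by rewrite lev_anc; lia.
by rewrite (big_rem _ cz) /= /desc eqxx (ltnW ix).
Qed.

Lemma count_desc_step F i z : \sum_(x <- F) desc i.+1 z x <=
  \sum_(c <- children z) \sum_(x <- F) desc i c x.
Proof. by rewrite exchange_big; apply: leq_sum => x _; exact: desc_step. Qed.

Lemma count_desc0 F z : \sum_(x <- F) desc 0 z x <= 1.
Proof.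
rewrite (eq_bigr (fun x => if x == z then 1 else 0)); last first.
  by move=> x _; rewrite /desc /=; case: eqP.
rewrite -big_mkcond sum1_count.
by rewrite -/(count_mem z F) count_uniq_mem ?fset_uniq// leq_b1.
Qed.

Variable b : nat.
Hypothesis nu_le : forall x : T, nu x <= b.+1.

(** Below the root a vertex spends one neighbour on its parent. *)
Lemma count_desc_pos F i z : 0 < lev o z -> \sum_(x <- F) desc i z x <= b ^ i.
Proof.
elim: i z => [|i IH] z z0; first exact: count_desc0.
apply: leq_trans (count_desc_step _ _ _) _.
apply: (@leq_trans (\sum_(c <- children z) b ^ i)).
  rewrite big_seq [leqRHS]big_seq; apply: leq_sum => c /childrenP[c0 _].
  exact: IH.
by rewrite big_const_seq count_predT iter_addn_0 mulnC expnS leq_mul ?card_children_lt.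
Qed.

(** Only the root can have [b.+1] children, and [b.+1 <= 2 * b]. *)
Lemma count_desc F i z : 0 < b -> \sum_(x <- F) desc i z x <= 2 * b ^ i.
Proof.
move=> b0; case: i => [|i]; first by rewrite (leq_trans (count_desc0 _ _)).
apply: leq_trans (count_desc_step _ _ _) _.
apply: (@leq_trans (\sum_(c <- children z) b ^ i)).
  rewrite big_seq [leqRHS]big_seq; apply: leq_sum => c /childrenP[c0 _].
  exact: count_desc_pos.
rewrite big_const_seq count_predT iter_addn_0 mulnC expnS mulnA leq_mul//.
by rewrite (leq_trans (card_children_le (nu_le z)))//; lia.
Qed.

End Growth.

Section Balls.
Local Open Scope fset_scope.
Local Open Scope nat_scope.
Variable (T : tree).
Hypothesis finite_neighbours : forall x : T, finite_set (neighbours x).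
Implicit Types (x y z o : T) (F : {fset T}).

Lemma finite_tball x r : finite_set (tball x r).
Proof.
elim: r => [|r IH].
  apply: (@sub_finite_set _ _ [set x]) => // y /=.
  by rewrite /tball /= leqn0 => /eqP/dist_eq0 ->.
apply: (@sub_finite_set _ _
   ([set x] `|` \bigcup_(z in tball x r) neighbours z)%classic).
  move=> y; rewrite /tball /= => yr.
  case: (posnP (lev x y)) => [/lev_eq0 ->|y0]; [by left|right].
  exists (par x y); last exact: adj_par.
  by move: (lev_par x y); rewrite /lev /= => ->; move: y0; rewrite /lev; lia.
rewrite finite_setU; split => //; exact: bigcup_finite.
Qed.

Definition ballf x r : {fset T} := fset_set (tball x r).
Definition sphere x r : {fset T} := [fset y in ballf x r | dist x y == r].

Lemma in_ballf x r y : (y \in ballf x r) = (dist x y <= r).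
Proof.
rewrite in_fset_set; last exact: finite_tball.
by apply/idP/idP => [/set_mem|?]; last exact/mem_set.
Qed.

Lemma in_sphere x r y : (y \in sphere x r) = (dist x y == r).
Proof.
by rewrite !inE/= in_ballf; case: eqP => [->|]; rewrite ?leqnn ?andbF.
Qed.

Lemma card_ballf x r : #|` ballf x r| = \sum_(k < r.+1) #|` sphere x k|.
Proof.
elim: r => [|r IH].
  rewrite big_ord1; congr #|` _|; apply/fsetP => y.
  by rewrite in_sphere in_ballf leqn0.
rewrite big_ord_recr /= -IH -cardfsUI.
have -> : ballf x r `&` sphere x r.+1 = fset0.
  by apply/fsetP => y; rewrite in_fsetI in_ballf in_sphere inE; apply/negP; lia.
rewrite cardfs0 addn0; congr #|` _|; apply/fsetP => y.
by rewrite in_fsetU !in_ballf in_sphere; lia.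
Qed.

Lemma card_sphere_le b x r : 0 < b -> (forall z : T, nu z <= b.+1) ->
  #|` sphere x r| <= 2 * b ^ r.
Proof.
move=> b0 nu_le.
apply: leq_trans (count_desc x finite_neighbours nu_le (sphere x r) r x b0).
rewrite -sum1_size big_seq [leqRHS]big_seq; apply: leq_sum => y.
rewrite in_sphere => /eqP levy.
by rewrite /desc {1}/lev levy leqnn /= -levy -/(lev x y) anc_lev eqxx.
Qed.

(** Rooting the tree at [x] makes the sphere a level, and each vertex of a level
    has at least [a] children, which no other vertex shares. *)
Lemma card_sphere_ge a x r : (forall z : T, a.+1 <= nu z) ->
  a ^ r <= #|` sphere x r|.
Proof.
move=> nu_ge; elim: r => [|r IH].
  rewrite expn0 cardfs_gt0; apply/fset0Pn; exists x.
  by rewrite in_sphere distxx.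
apply: (@leq_trans (\sum_(z <- sphere x r) #|` children x z|)).
  apply: (@leq_trans (\sum_(z <- sphere x r) a)).
    by rewrite big_const_seq count_predT iter_addn_0 mulnC expnSr leq_mul.
  by apply: leq_sum => z _; apply: card_children_ge.
apply: (@leq_trans (\sum_(z <- sphere x r) \sum_(y <- sphere x r.+1) (par x y == z))).
  rewrite big_seq [leqRHS]big_seq; apply: leq_sum => z.
  rewrite in_sphere => /eqP levz.
  rewrite (eq_bigr (fun y => if par x y == z then 1 else 0)); last first.
    by move=> y _; case: eqP.
  rewrite -big_mkcond /= -big_filter !sum1_size uniq_leq_size ?fset_uniq//.
  move=> y /(childrenP _ finite_neighbours)[y0 ey]; rewrite mem_filter ey eqxx.
  rewrite in_sphere /=; have := lev_par x y; rewrite ey /lev levz /=.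
  by move: y0; rewrite /lev; lia.
rewrite exchange_big /= -[leqRHS]sum1_size; apply: leq_sum => y _.
rewrite (eq_bigr (fun z => if z == par x y then 1 else 0)); last first.
  by move=> z _; rewrite eq_sym; case: eqP.
by rewrite -big_mkcond sum1_count count_uniq_mem ?fset_uniq// leq_b1.
Qed.

End Balls.

(** * Weak type (1,1) bounds for families of cones *)

Section Cones.
Local Open Scope fset_scope.
Local Open Scope ring_scope.
Context {R : realType}.
Variables (T : tree) (o : T) (b : nat).
Hypothesis finite_neighbours : forall x : T, finite_set (neighbours x).
Hypothesis nu_le : forall x : T, (nu x <= b.+1)%N.
Hypothesis b_gt0 : (0 < b)%N.
Implicit Types (x y z : T) (X G : {fset T}) (f : T -> R).

Lemma sum_desc_le X i z :
  \sum_(x <- X | desc o i z x) (1 : R) <= 2 * b%:R ^+ i.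
Proof.
rewrite -natrX -natrM big_mkcond /=.
rewrite (eq_bigr (fun x => (desc o i z x)%:R)); last by move=> x _; case: desc.
by rewrite -natr_sum ler_nat; exact: count_desc.
Qed.

(** With [z = anc (n + u) x], the pairs such that [y] lies at depth [n + v] below
    [z]. As [n] grows these sets of [y] increase, for [(u, v) = (0, m)] along the
    diagonal of pairs [(i, i + m)] and for [(u, v) = (m, 0)] along that of pairs
    [(j + m, j)]. *)
Definition cone n u v x y :=
  [&& n + u <= lev o x, n + v <= lev o y & anc o (n + u) x == anc o (n + v) y]%N.

(** The apex of the larger cone is determined by the common point [y], and it lies
    above the apex of the smaller cone. *)
Lemma cone_nested m n u v x x' y : (m <= n)%N ->
  cone m u v x y -> cone n u v x' y -> cone n u v x =1 cone n u v x'.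
Proof.
move=> mn /and3P[xm ym /eqP exy] /and3P[xn yn /eqP exy'].
have elev : lev o x = lev o x'.
  have := congr1 (lev o) exy; have := congr1 (lev o) exy'; rewrite !lev_anc; lia.
have ea : anc o (n + u) x = anc o (n + u) x'.
  have split_n w : (n + w = (n - m) + (m + w))%N by lia.
  by rewrite exy' !split_n !(ancD _ (n - m)) exy.
by move=> w; rewrite /cone elev ea.
Qed.

(** Weak type (1,1) of a maximal function over nested sets. Take for each [x] the
    largest admissible [n x]. By nestedness, all [x] whose largest cone contains a
    given [y] have the same [n x], so they are descendants of one vertex at depth
    [n x + u], and the sum of their weights [b ^- n x] is at most [2 * b ^ u].
    Summing against [f y] counts every [x] at least [s] times. *)
Lemma cone_maximal_bound X G f u v (s : R) : 0 <= s ->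
  (forall y, 0 <= f y) ->
  (forall x, x \in X -> exists n, s * b%:R ^+ n < \sum_(y <- G | cone n u v x y) f y) ->
  s * #|` X|%:R <= 2 * b%:R ^+ u * \sum_(y <- G) f y.
Proof.
move=> s0 f0 H.
have bR : 0 < b%:R :> R by rewrite ltr0n.
pose Q x n := s * b%:R ^+ n < \sum_(y <- G | cone n u v x y) f y.
have /choice[n nP] x : exists n, x \in X -> Q x n /\ forall m, Q x m -> (m <= n)%N.
  have [xX|_] := boolP (x \in X); last by exists 0%N.
  have bounded m : Q x m -> (m <= lev o x)%N.
    apply: contraTT; rewrite -ltnNge /Q -leNgt => ltm.
    rewrite big_pred0 ?mulr_ge0 ?exprn_ge0 ?(ltW bR)// => y; apply/negP => /and3P[]; lia.
  have [m mQ m_max] := ex_maxnP (H x xX) bounded.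
  by exists m.
have point y : \sum_(x <- X | cone (n x) u v x y) (b%:R ^- n x : R) <= 2 * b%:R ^+ u.
  have [/hasP[x0 x0X x0y]|/hasPn noX] := boolP (has (fun x => cone (n x) u v x y) X);
    last first.
    rewrite big_seq_cond big_pred0 ?mulr_ge0 ?exprn_ge0 ?(ltW bR)// => x.
    by apply/negP => /andP[/noX/negP].
  have same x : x \in X -> cone (n x) u v x y -> n x = n x0.
    have half x1 x2 : x1 \in X -> x2 \in X -> cone (n x1) u v x1 y ->
        cone (n x2) u v x2 y -> (n x2 <= n x1)%N.
      move=> x1X x2X c1 c2; case: leqP => // lt12; have le12 := ltnW lt12.
      have := (nP x1 x1X).2 (n x2); have := (nP x2 x2X).1; rewrite /Q.
      by rewrite -(eq_bigl _ _ (cone_nested le12 c1 c2)) => + Hle => /Hle; lia.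
    by move=> xX cx; apply/eqP; rewrite eqn_leq !half.
  apply: (@le_trans _ _ (b%:R ^- n x0 *
     \sum_(x <- X | desc o (n x0 + u) (anc o (n x0 + v) y) x) 1 : R)); last first.
    rewrite ler_pdivrMl ?exprn_gt0// (le_trans (sum_desc_le _ _ _))//.
    by rewrite exprD; lra.
  rewrite big_distrr /= big_seq_cond [leRHS]big_mkcond [leLHS]big_mkcond big_seq [leRHS]big_seq.
  apply: ler_sum => x xX; rewrite xX /=.
  have [cx|_] := boolP (cone _ _ _ _ _); last first.
    by case: ifP => // _; rewrite mulr1 invr_ge0 exprn_ge0// ltW.
  have enx := same x xX cx; move: cx; rewrite enx => /and3P[cx _ ea].
  by rewrite /desc cx ea mulr1.
apply: (@le_trans _ _ (\sum_(x <- X) \sum_(y <- G | cone (n x) u v x y) b%:R ^- n x * f y)).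
  rewrite -sum1_size natr_sum mulr_sumr big_seq [leRHS]big_seq; apply: ler_sum => x xX.
  rewrite mulr1 -big_distrr /= mulrC ler_pdivlMr ?exprn_gt0//.
  exact/ltW/(nP x xX).1.
rewrite (exchange_big_dep xpredT) //= mulr_sumr; apply: ler_sum => y _.
by rewrite -mulr_suml ler_wpM2r.
Qed.

Lemma sum_geom_nat I : (1 < b)%N -> \sum_(i < I.+1) (b%:R : R) ^+ i <= 2 * b%:R ^+ I.
Proof.
move=> b1; elim: I => [|I IH]; first by rewrite big_ord1 expr0; lra.
rewrite big_ord_recr /= (le_trans (lerD IH (lexx _)))//.
rewrite mulr2n [in leRHS]mulrDl mul1r lerD2r exprS ler_wpM2r ?exprn_ge0//.
by rewrite (ler_nat R 2 b).
Qed.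

(** Group the points [x] by the apex [z = anc i x]. Those with apex [z] lie at
    depths [i] with [s * b ^ i < Phi z], where [Phi z] is the sum of [f] over the
    descendants of [z] at depth [j], so by a geometric sum there are at most
    [4 * Phi z / s] of them. As [j] is fixed, each [y] counts in one [Phi z] only. *)
Lemma cone_apex_bound X G f j (s : R) : (1 < b)%N -> 0 <= s ->
  (forall y, 0 <= f y) ->
  (forall x, x \in X -> exists2 i, (i <= lev o x)%N &
     s * b%:R ^+ i < \sum_(y <- G | desc o j (anc o i x) y) f y) ->
  s * #|` X|%:R <= 4 * \sum_(y <- G) f y.
Proof.
move=> b1 s0 f0 H.
have bR : 0 < b%:R :> R by rewrite ltr0n.
have /choice[i iP] x : exists i, x \in X -> (i <= lev o x)%N /\
     s * b%:R ^+ i < \sum_(y <- G | desc o j (anc o i x) y) f y.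
  have [xX|_] := boolP (x \in X); last by exists 0%N.
  by have [i ? ?] := H x xX; exists i.
pose Z := [fset anc o (i x) x | x in X].
pose Phi z := \sum_(y <- G | desc o j z y) f y.
have point z : s * \sum_(x <- X | anc o (i x) x == z) 1 <= 4 * Phi z.
  have [/hasP[x0 x0X x0z]|/hasPn noX] := boolP (has (fun x => anc o (i x) x == z) X);
    last first.
    rewrite big_seq_cond big_pred0.
      by rewrite mulr0 mulr_ge0// sumr_ge0.
    by move=> x; apply/negP => /andP[/noX/negP].
  pose Q I := has (fun x => (anc o (i x) x == z) && (i x == I)) X.
  have exQ : exists I, Q I by exists (i x0); apply/hasP; exists x0; rewrite ?x0z ?eqxx.
  have bQ I : Q I -> (I <= \max_(x <- X) i x)%N.
    by move=> /hasP[x xX /andP[_ /eqP <-]]; exact: leq_bigmax_seq.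
  have [I /hasP[x1 x1X /andP[/eqP ez /eqP eI]] I_max] := ex_maxnP exQ bQ.
  have ltI : s * b%:R ^+ I < Phi z by have := (iP x1 x1X).2; rewrite ez eI.
  apply: (@le_trans _ _ (s * \sum_(k < I.+1) \sum_(x <- X | desc o k z x) 1)).
    apply: ler_wpM2l => //; rewrite (exchange_big_dep xpredT) //= big_mkcond /=.
    rewrite big_seq [leRHS]big_seq; apply: ler_sum => x xX.
    case: ifP => xz; last by rewrite sumr_ge0.
    have ixI : (i x < I.+1)%N.
      by rewrite ltnS I_max//; apply/hasP; exists x => //; rewrite xz eqxx.
    rewrite (bigD1 (Ordinal ixI)) /=; last by rewrite /desc (iP x xX).1.
    by rewrite lerDl sumr_ge0.
  apply: (@le_trans _ _ (s * (2 * (2 * b%:R ^+ I)))); last lra.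
  apply: ler_wpM2l => //.
  apply: (@le_trans _ _ (\sum_(k < I.+1) 2 * b%:R ^+ k : R)).
    by apply: ler_sum => k _; exact: sum_desc_le.
  by rewrite -mulr_sumr ler_wpM2l// sum_geom_nat.
apply: (@le_trans _ _ (\sum_(z <- Z) s * \sum_(x <- X | anc o (i x) x == z) 1)).
  rewrite -mulr_sumr (exchange_big_dep xpredT) //= -sum1_size natr_sum.
  apply: ler_wpM2l => //; rewrite big_seq [leRHS]big_seq; apply: ler_sum => x xX.
  have zZ : anc o (i x) x \in Z by apply/imfsetP; exists x.
  by rewrite (big_rem _ zZ) /= eqxx lerDl sumr_ge0.
apply: le_trans (ler_sum _ (fun z _ => point z)) _.
rewrite -mulr_sumr ler_wpM2l// /Phi (exchange_big_dep xpredT) //=.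
apply: ler_sum => y _.
rewrite -[leRHS]mul1r -[f y in leLHS]mul1r -mulr_suml ler_wpM2r//.
apply: (@le_trans _ _ (\sum_(z <- Z | z == anc o j y) 1 : R)).
  rewrite big_mkcond [leRHS]big_mkcond; apply: ler_sum => z _.
  by rewrite /desc eq_sym; case: eqP => _; rewrite ?andbF ?andbT //; case: ifP.
rewrite -(natr_sum _ _ _ (fun=> 1%N)) -big_filter sum1_size.
rewrite -[leRHS]/(1%:R) ler_nat size_filter.
by rewrite count_uniq_mem ?fset_uniq// leq_b1.
Qed.

End Cones.

(** * Finite sums *)

Section FiniteSums.
Local Open Scope fset_scope.
Local Open Scope ring_scope.
Context {R : realType}.

Lemma ler_sum_uniq (I : eqType) (s t : seq I) (g : I -> R) :
  uniq s -> uniq t -> {subset s <= t} -> (forall i, 0 <= g i) ->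
  \sum_(i <- s) g i <= \sum_(i <- t) g i.
Proof.
move=> us ut st g0.
have pst : perm_eq s [seq i <- t | i \in s].
  apply: uniq_perm; rewrite ?filter_uniq// => i.
  by rewrite mem_filter; case: (boolP (i \in s)) => //= /st ->.
rewrite (perm_big _ pst) big_filter big_mkcond; apply: ler_sum => i _.
by case: ifP.
Qed.

Lemma geometric_sum_le (q : R) n : 0 <= q < 1 ->
  \sum_(0 <= i < n) q ^+ i <= (1 - q)^-1.
Proof.
move=> /andP[q0 q1]; rewrite -[leRHS]mul1r ler_pdivlMr ?subr_gt0// mulrC.
elim: n => [|n IH]; first by rewrite big_geq// mulr0.
suff -> : (1 - q) * \sum_(0 <= i < n.+1) q ^+ i = 1 - q ^+ n.+1.
  by rewrite gerBl exprn_ge0.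
elim: n {IH} => [|n IH]; first by rewrite big_nat1 expr0 expr1 mulr1.
by rewrite big_nat_recr//= mulrDr IH mulrBl mul1r -exprS; ring.
Qed.

Lemma geometric_sum_uniq_le (q : R) (s : seq nat) : 0 <= q < 1 -> uniq s ->
  \sum_(i <- s) q ^+ i <= (1 - q)^-1.
Proof.
move=> q01 us; apply: le_trans (geometric_sum_le (\max_(i <- s) i).+1 q01).
apply: ler_sum_uniq; rewrite ?iota_uniq//.
- by move=> i si; rewrite mem_index_iota leq0n ltnS /=; exact: leq_bigmax_seq.
- by move=> i; rewrite exprn_ge0//; case/andP: q01.
Qed.

(** Along a sphere the exponents are affine in the index with slope 2, so their
    values are distinct but not consecutive. *)
Lemma geometric_sum_inj_le (q : R) (s : seq nat) (P : pred nat) (e : nat -> nat) :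
  0 <= q < 1 -> uniq s -> {in [pred i | P i && (i \in s)] &, injective e} ->
  \sum_(i <- s | P i) q ^+ (e i) <= (1 - q)^-1.
Proof.
move=> q01 us e_inj; rewrite -big_filter -(big_map e xpredT (fun n => q ^+ n)).
apply: geometric_sum_uniq_le => //; rewrite map_inj_in_uniq ?filter_uniq//.
by move=> i j; rewrite !mem_filter; exact: e_inj.
Qed.

Lemma sum_pigeonhole (I : eqType) (s : seq I) (a c : I -> R) :
  \sum_(i <- s) c i < \sum_(i <- s) a i -> exists2 i, i \in s & c i < a i.
Proof.
move=> ltca; have [/hasP//|/hasPn noi] := boolP (has (fun i => c i < a i) s).
move: ltca; rewrite ltNge big_seq [leRHS]big_seq ler_sum// => i si.
by rewrite leNgt noi.
Qed.

Lemma card_cover (K : choiceType) (X : {fset K}) (P : nat -> pred K) n :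
  (forall x, x \in X -> exists2 j, (j < n)%N & P j x) ->
  #|` X|%:R <= \sum_(0 <= j < n) (#|` [fset x in X | P j x]|%:R : R).
Proof.
move=> H; rewrite -natr_sum ler_nat -sum1_size.
apply: (@leq_trans (\sum_(x <- X) \sum_(0 <= j < n) P j x)).
  rewrite big_seq [leqRHS]big_seq; apply: leq_sum => x /H[j jn Pj].
  rewrite (@big_rem _ _ _ _ _ j) ?mem_index_iota//=.
  by rewrite Pj.
rewrite exchange_big; apply: leq_sum => j _.
rewrite (eq_bigr (fun x => if P j x then 1 else 0)%N); last by move=> x _; case: (P j x).
rewrite -big_mkcond -big_filter sum1_size uniq_leq_size ?filter_uniq// => x.
by rewrite mem_filter !inE /= andbC => ->.
Qed.

End FiniteSums.

(** * Sums over spheres, and the weak type (1,1) bound *)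

Section Spheres.
Local Open Scope fset_scope.
Local Open Scope ring_scope.
Context {R : realType}.
Variables (T : tree) (b : nat).
Hypothesis finite_neighbours : forall x : T, finite_set (neighbours x).
Hypothesis nu_le : forall x : T, (nu x <= b.+1)%N.
Implicit Types (x y z : T) (X G : {fset T}) (f : T -> R).

Local Notation o := (point : T).

Definition common_anc i j x y :=
  [&& i <= lev o x, j <= lev o y & anc o i x == anc o j y]%N.

Lemma sphere_sum_le G f k x : (forall y, 0 <= f y) ->
  \sum_(y <- G | dist x y == k) f y <=
  \sum_(0 <= i < k.+1) \sum_(y <- G | common_anc i (k - i) x y) f y.
Proof.
move=> f0; rewrite (exchange_big_dep xpredT)//= big_mkcond; apply: ler_sum => y _.
case: eqP => [dk|_]; last by rewrite sumr_ge0.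
have [i [j [ij ix jy e]]] := confluence o x y.
rewrite dk in ij; have ki : (k - i = j)%N by lia.
rewrite (@big_rem _ _ _ _ _ i) ?mem_index_iota /=; last lia.
by rewrite {1}/common_anc ix ki jy e eqxx /= lerDl sumr_ge0.
Qed.

(** The thresholds [s / 4 * b ^ k * (3 / 4) ^ j] sum over [j] to at most [s * b ^ k],
    so one of the terms [i + j = k] exceeds its threshold. Since
    [3 / 2 <= b * (3 / 4)], the sets of points [x] found in this way for the various
    [j] have sizes that decrease geometrically. *)
Lemma weak_type_11_spheres G X f (k : T -> nat) (s : R) : (1 < b)%N -> 0 <= s ->
  (forall y, 0 <= f y) ->
  (forall x, x \in X -> s * b%:R ^+ (k x) < \sum_(y <- G | dist x y == k x) f y) ->
  s * #|` X|%:R <= 48 * \sum_(y <- G) f y.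
Proof.
move=> b1 s0 f0 H.
have b2 : 2 <= b%:R :> R by rewrite ler_nat.
pose q : R := 3 / 4.
have q01 : 0 <= q < 1 by rewrite /q; apply/andP; split; lra.
pose P j x := `[< exists2 i, (i <= lev o x)%N &
   s / 4 * (b%:R * q) ^+ j * b%:R ^+ i < \sum_(y <- G | desc o j (anc o i x) y) f y >].
pose N := (\max_(x <- X) k x).+1.
have cover x : x \in X -> exists2 j, (j < N)%N & P j x.
  move=> xX; have := lt_le_trans (H x xX) (sphere_sum_le G (k x) x f0).
  have small : \sum_(0 <= i < (k x).+1) s * b%:R ^+ (k x) / 4 * q ^+ (k x - i) <=
               s * b%:R ^+ (k x).
    rewrite -mulr_sumr -mulrA ler_piMr ?mulr_ge0 ?exprn_ge0 ?ler0n//.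
    rewrite ler_pdivrMl// mulr1.
    apply: le_trans (geometric_sum_inj_le (e := subn (k x)) q01 (iota_uniq _ _) _) _; last first.
      by rewrite (_ : 1 - q = 4^-1) ?invrK//; rewrite /q; lra.
    move=> i j /andP[_ +] /andP[_ +]; rewrite !mem_iota; lia.
  move=> /(le_lt_trans small)/sum_pigeonhole[i].
  rewrite mem_index_iota => /andP[_ ik] lti.
  exists (k x - i)%N.
    rewrite /N ltnS (leq_trans (leq_subr _ _))//; exact: leq_bigmax_seq.
  have le_sum : \sum_(y <- G | common_anc i (k x - i) x y) f y <=
      \sum_(y <- G | desc o (k x - i) (anc o i x) y) f y.
    rewrite big_mkcond [leRHS]big_mkcond; apply: ler_sum => y _.
    case: ifP => [/and3P[_ jy /eqP e]|_]; last by case: ifP.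
    by rewrite /desc jy e eqxx.
  have [ix|ix] := leqP i (lev o x).
    apply/asboolP; exists i => //; apply: lt_le_trans le_sum.
    apply: le_lt_trans lti; rewrite exprMn.
    have -> : b%:R ^+ k x = b%:R ^+ (k x - i) * b%:R ^+ i :> R.
      by rewrite -exprD subnK.
    by rewrite le_eqVlt; apply/orP; left; apply/eqP; ring.
  move: lti; rewrite big_pred0; last by move=> y; rewrite /common_anc leqNgt ix.
  rewrite ltNge !mulr_ge0 ?invr_ge0 ?exprn_ge0 ?ler0n//; lra.
apply: (@le_trans _ _ (s * \sum_(0 <= j < N) #|` [fset x in X | P j x]|%:R)).
  by rewrite ler_wpM2l// card_cover.
rewrite mulr_sumr.
have term j : s * #|` [fset x in X | P j x]|%:R <=
    16 * (\sum_(y <- G) f y) * (2 / 3) ^+ j.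
  have := @cone_apex_bound R T o b finite_neighbours nu_le (ltnW b1)
     [fset x in X | P j x] G f j (s / 4 * (b%:R * q) ^+ j) b1.
  have bq : 3 / 2 <= b%:R * q by rewrite /q; lra.
  have bqj : (3 / 2) ^+ j <= (b%:R * q) ^+ j.
    by rewrite lerXn2r ?nnegrE//; lra.
  have bqj0 : 0 <= (3 / 2) ^+ j :> R by rewrite exprn_ge0//; lra.
  move=> /(_ _ f0 _)/wrap[]; first by rewrite !mulr_ge0//; lra.
    by move=> x; rewrite !inE => /andP[_ /asboolP].
  move=> le4; have S0 : 0 <= \sum_(y <- G) f y by rewrite sumr_ge0.
  have e1 : (3 / 2) ^+ j * (2 / 3) ^+ j = 1 :> R.
    by rewrite -exprMn (_ : 3 / 2 * (2 / 3) = 1) ?expr1n//; lra.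
  have p0 : 0 <= (2 / 3) ^+ j :> R by rewrite exprn_ge0//; lra.
  set n := #|` _|%:R in le4 *.
  have n0 : 0 <= n :> R by rewrite ler0n.
  have step : s * n * (3 / 2) ^+ j <= 16 * \sum_(y <- G) f y.
    apply: (@le_trans _ _ (s * n * (b%:R * q) ^+ j)).
      by rewrite ler_wpM2l ?mulr_ge0.
    by lra.
  rewrite -[leLHS]mulr1 -[X in _ * X <= _]e1 mulrA; by apply: ler_wpM2r.
apply: le_trans (ler_sum _ (fun j _ => term j)) _.
rewrite -mulr_sumr.
have S0 : 0 <= \sum_(y <- G) f y by rewrite sumr_ge0.
apply: (@le_trans _ _ (16 * (\sum_(y <- G) f y) * (1 - 2 / 3)^-1)).
  by rewrite ler_wpM2l ?mulr_ge0// geometric_sum_le//; apply/andP; split; lra.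
by rewrite (_ : 1 - 2 / 3 = 3^-1) ?invrK; lra.
Qed.

End Spheres.

(** * Indicator functions on spheres, diagonal by diagonal *)

Section DiagonalIndices.
Local Open Scope nat_scope.
(** In the next four lemmas [i] and [k - i] are the heights of a common ancestor above
    two vertices at distance [k]: these are the facts on the difference of the two
    heights that the sum of the thresholds needs. *)
Lemma diag_inj k i j : i <= k -> j <= k -> i <= k - i -> j <= k - j ->
  k - i - i = k - j - j -> i = j.
Proof.
move=> /subnKC; move: (k - i) => a ea /subnKC; move: (k - j) => c ec ? ? ?; lia.
Qed.
Lemma antidiag_inj k m i j : i <= k -> j <= k -> k - i < i -> k - j < j ->
  i - (k - i) <= m -> j - (k - j) <= m ->
  m - (i - (k - i)) = m - (j - (k - j)) -> i = j.
Proof.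
move=> /subnKC; move: (k - i) => a ea /subnKC; move: (k - j) => c ec ? ? ? ? ?; lia.
Qed.
Lemma antidiag_tail_inj k m i j : i <= k -> j <= k -> k - i < i -> k - j < j ->
  m < i - (k - i) -> m < j - (k - j) ->
  i - (k - i) - m = j - (k - j) - m -> i = j.
Proof.
move=> /subnKC; move: (k - i) => a ea /subnKC; move: (k - j) => c ec ? ? ? ? ?; lia.
Qed.

Lemma antidiag_exponent k m i : i <= k -> k - i < i -> m < i - (k - i) ->
  2 * (k - i) + (m + (i - (k - i) - m)) <= k.
Proof. by move=> /subnKC; move: (k - i) => a ea ? ?; lia. Qed.

End DiagonalIndices.

Lemma in_fset_cond (K : choiceType) (X : {fset K}) (P : pred K) x :
  (x \in [fset x in X | P x]%fset) = (x \in X) && P x.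
Proof. by rewrite !inE. Qed.

Section Diagonals.
Local Open Scope fset_scope.
Local Open Scope ring_scope.
Context {R : realType}.
Variables (T : tree) (b : nat).
Hypothesis finite_neighbours : forall x : T, finite_set (neighbours x).
Hypothesis nu_le : forall x : T, (nu x <= b.+1)%N.
Hypothesis b_gt0 : (0 < b)%N.
Implicit Types (x y z : T) (X G E : {fset T}).

Local Notation o := (point : T).

Variables alpha beta : R.
Hypothesis beta_gt1 : 1 < beta.
Hypothesis beta_le_alpha : beta <= alpha.
Hypothesis alpha_beta : alpha * beta = b%:R.

(** A ratio strictly between [beta^-1] and [1]: the thresholds decrease
    geometrically with ratio [delta], and the number of points above them with
    ratio [theta]. *)
Definition delta : R := (1 + beta^-1) / 2.
Definition theta : R := (beta * delta)^-1.

Lemma delta_bounds : [/\ 0 < delta, delta < 1 & 1 < beta * delta].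
Proof.
move: (beta_gt1) (beta_le_alpha) => b1 ba.
have bi : 0 < beta^-1 by rewrite invr_gt0; lra.
have bi1 : beta^-1 < 1 by rewrite invf_lt1; lra.
rewrite /delta; split; [lra|lra|].
have bn0 : beta != 0 by rewrite gt_eqF//; lra.
by rewrite mulrA mulrDr mulr1 divff//; lra.
Qed.

(** Thresholds for the terms [i + j = k] of a sphere sum, of three kinds. For [i <= j]
    and for [0 < i - j <= m1] they decrease geometrically away from [i = j] and
    from [i - j = m1] respectively. For [m1 < i - j] the threshold is the bound on
    the number of descendants at depth [j], which a term never exceeds. *)
Definition level_bound (lam : R) (k m1 i : nat) : R :=
  let j := (k - i)%N in
  if (i <= j)%N then alpha ^+ k * (lam * (1 - delta) / 4) * delta ^+ (j - i)
  else if (i - j <= m1)%N then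
    alpha ^+ k * (lam * (1 - delta) / 4) * delta ^+ (m1 - (i - j))
  else 2 * b%:R ^+ j.

(** The first two kinds of thresholds contribute at most a quarter of the right-hand
    side each. The third kind is at most [2 * alpha ^ k * alpha ^- (i - j)] because
    [b <= alpha ^+ 2], and the condition on [m1] makes the tail of this geometric
    series at most half of the right-hand side. *)
Lemma sum_level_bound lam k m1 : 0 <= lam ->
  4 * alpha / (alpha - 1) <= lam * alpha ^+ m1 ->
  \sum_(0 <= i < k.+1) level_bound lam k m1 i <= lam * alpha ^+ k.
Proof.
move: (beta_gt1) (beta_le_alpha) => b1 ba.
have [d0 d1 _] := delta_bounds.
move=> lam0 hm1; rewrite /level_bound.
have a1 : 1 < alpha by lra.
have ai01 : 0 <= alpha^-1 < 1 by rewrite invr_ge0 invf_lt1 ?(ltW a1); lra.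
have d01 : 0 <= delta < 1 by rewrite (ltW d0).
have ak : 0 < alpha ^+ k by rewrite exprn_gt0; lra.
set c := lam * (1 - delta) / 4.
have c0 : 0 <= alpha ^+ k * c by rewrite !mulr_ge0//; lra.
rewrite (bigID (fun i => i <= k - i)%N) /=.
rewrite [X in _ + X](bigID (fun i => i - (k - i) <= m1)%N) /=.
have cD : alpha ^+ k * c * (1 - delta)^-1 = alpha ^+ k * lam / 4.
  by rewrite /c; field; rewrite subr_eq0 gt_eqF.
have le1 : \sum_(0 <= i < k.+1 | (i <= k - i)%N)
    (if (i <= k - i)%N then alpha ^+ k * c * delta ^+ (k - i - i)
     else if (i - (k - i) <= m1)%N then alpha ^+ k * c * delta ^+ (m1 - (i - (k - i)))
     else 2 * b%:R ^+ (k - i)) <= alpha ^+ k * lam / 4.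
  rewrite (eq_bigr (fun i => alpha ^+ k * c * delta ^+ (k - i - i))); last first.
    by move=> i ->.
  rewrite -mulr_sumr -cD ler_wpM2l//.
  apply: (geometric_sum_inj_le (e := fun i => k - i - i)%N d01 (iota_uniq _ _)).
  move=> i j /andP[Pi +] /andP[Pj +]; rewrite !mem_iota !leq0n subn0 !ltnS => ik jk.
  exact: (diag_inj ik jk Pi Pj).
have le2 : \sum_(0 <= i < k.+1 | ~~ (i <= k - i)%N && (i - (k - i) <= m1)%N)
    (if (i <= k - i)%N then alpha ^+ k * c * delta ^+ (k - i - i)
     else if (i - (k - i) <= m1)%N then alpha ^+ k * c * delta ^+ (m1 - (i - (k - i)))
     else 2 * b%:R ^+ (k - i)) <= alpha ^+ k * lam / 4.
  rewrite (eq_bigr (fun i => alpha ^+ k * c * delta ^+ (m1 - (i - (k - i))))); last first.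
    by move=> i /andP[/negPf -> ->].
  rewrite -mulr_sumr -cD ler_wpM2l//.
  apply: (geometric_sum_inj_le (e := fun i => m1 - (i - (k - i)))%N d01 (iota_uniq _ _)).
  move=> i j /andP[/andP[+ Pi] +] /andP[/andP[+ Pj] +].
  rewrite !mem_iota !leq0n subn0 !ltnS -!ltnNge => ai ik aj jk.
  exact: (antidiag_inj ik jk).
have le3 : \sum_(0 <= i < k.+1 | ~~ (i <= k - i)%N && ~~ (i - (k - i) <= m1)%N)
    (if (i <= k - i)%N then alpha ^+ k * c * delta ^+ (k - i - i)
     else if (i - (k - i) <= m1)%N then alpha ^+ k * c * delta ^+ (m1 - (i - (k - i)))
     else 2 * b%:R ^+ (k - i)) <= alpha ^+ k * lam / 2.
  apply: (@le_trans _ _ (\sum_(0 <= i < k.+1 | ~~ (i <= k - i)%N && ~~ (i - (k - i) <= m1)%N)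
     2 * alpha ^+ k * (alpha ^- m1) * (alpha^-1) ^+ (i - (k - i) - m1))).
    rewrite big_seq_cond [leRHS]big_seq_cond; apply: ler_sum => i.
    rewrite mem_index_iota ltnS => /andP[/andP[_ ik] /andP[ai bi]].
    rewrite (negPf ai) (negPf bi); rewrite -!ltnNge in ai bi.
    rewrite -!mulrA ler_wpM2l//.
    apply: (@le_trans _ _ ((alpha ^+ 2) ^+ (k - i))).
      rewrite lerXn2r ?nnegrE ?ler0n ?sqr_ge0// -alpha_beta expr2 ler_wpM2l//; lra.
    rewrite exprVn -invfM -exprD -exprM.
    rewrite ler_pdivlMr ?exprn_gt0//; last lra.
    rewrite -exprD ler_weXn2l ?(ltW a1)//.
    exact: antidiag_exponent.
  rewrite -mulr_sumr.
  apply: (@le_trans _ _ (2 * alpha ^+ k * alpha ^- m1 * (1 - alpha^-1)^-1)).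
    rewrite ler_wpM2l ?mulr_ge0 ?invr_ge0 ?exprn_ge0 ?(ltW ak)//; try lra.
    apply: (geometric_sum_inj_le (e := fun i => i - (k - i) - m1)%N ai01 (iota_uniq _ _)).
    move=> i j /andP[/andP[+ +] +] /andP[/andP[+ +] +].
    rewrite !mem_iota !leq0n subn0 !ltnS -!ltnNge => ai bi ik aj bj jk.
    exact: (antidiag_tail_inj ik jk).
  have -> : (1 - alpha^-1)^-1 = alpha / (alpha - 1).
    by field; rewrite subr_eq0 (gt_eqF a1) gt_eqF//; lra.
  have am : 0 < alpha ^+ m1 by rewrite exprn_gt0; lra.
  have : 4 * alpha / (alpha - 1) / alpha ^+ m1 <= lam by rewrite ler_pdivrMr.
  set A := alpha / (alpha - 1).
  have -> : 4 * alpha / (alpha - 1) / alpha ^+ m1 = 4 * (A / alpha ^+ m1).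
    by rewrite /A !mulrA.
  have -> : 2 * alpha ^+ k * alpha ^- m1 * A = 2 * alpha ^+ k * (A / alpha ^+ m1).
    by ring.
  move=> hA.
  have -> : alpha ^+ k * lam / 2 = 2 * alpha ^+ k * (lam / 4) by field.
  by rewrite ler_wpM2l ?mulr_ge0 ?(ltW ak)//; lra.
have := lerD le1 (lerD le2 le3); move/le_trans; apply.
by rewrite le_eqVlt; apply/orP; left; apply/eqP; field.
Qed.

Definition diag_case (m : nat) lam E x : bool :=
  `[< exists n, lam * (1 - delta) / 4 * (alpha * delta) ^+ m * b%:R ^+ n <
        \sum_(y <- E | cone o n 0 m x y) 1 >].

Definition antidiag_case (m m1 : nat) lam E x : bool :=
  `[< exists n, lam * (1 - delta) / 4 * alpha ^+ m * delta ^+ (m1 - m) * b%:R ^+ n <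
        \sum_(y <- E | cone o n m 0 x y) 1 >].

(** A term exceeds its threshold, and it is not of the third kind. *)
Lemma sphere_cases lam E k x m1 : 0 <= lam ->
  4 * alpha / (alpha - 1) <= lam * alpha ^+ m1 ->
  lam * alpha ^+ k < \sum_(y <- E | dist x y == k) 1 ->
  (exists2 m, (m < k.+1)%N & diag_case m lam E x) \/
  (exists2 m, (m < m1.+1)%N & antidiag_case m m1 lam E x).
Proof.
move: (beta_gt1) (beta_le_alpha) => b1 ba.
have [d0 d1 _] := delta_bounds.
move=> lam0 hm1 big.
have c0 : 0 <= lam * (1 - delta) / 4 by rewrite !mulr_ge0//; lra.
have := lt_le_trans big (sphere_sum_le E k x (fun=> ler01)).
move=> /(le_lt_trans (sum_level_bound k lam0 hm1))/sum_pigeonhole[i].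
rewrite mem_index_iota => /andP[_ ik]; rewrite /level_bound.
have b_le n : b%:R ^+ n <= alpha ^+ (n + n).
  rewrite -alpha_beta addnn -mul2n exprM lerXn2r ?nnegrE ?sqr_ge0//.
    by rewrite mulr_ge0; lra.
  by rewrite expr2 ler_wpM2l; lra.
have a0 : 0 <= alpha by lra.
case: ifP => [ij lti|/negbT]; [left|rewrite -ltnNge => ji].
  have [m jE] : exists m, (k - i = i + m)%N by exists (k - i - i)%N; rewrite subnKC.
  have kE : k = (i + i + m)%N by rewrite -addnA -jE subnKC.
  exists m; first by rewrite kE ltnS leq_addl.
  apply/asboolP; exists i; move: lti; rewrite jE addKn.
  rewrite (@eq_bigl _ _ _ _ _ (common_anc i (i + m) x) (cone o i 0 m x)); last first.
    by move=> y; rewrite /cone addn0.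
  apply: le_lt_trans.
  rewrite kE exprD [in leLHS]exprMn.
  move: (lam * _ / _) c0 => c c0.
  have -> : c * (alpha ^+ m * delta ^+ m) * b%:R ^+ i =
    (c * alpha ^+ m * delta ^+ m) * b%:R ^+ i by ring.
  have -> : alpha ^+ (i + i) * alpha ^+ m * c * delta ^+ m =
    (c * alpha ^+ m * delta ^+ m) * alpha ^+ (i + i) by ring.
  apply: ler_wpM2l (b_le _); rewrite !mulr_ge0 ?exprn_ge0 ?(ltW d0)//.
have [m iE] : exists m, (i = (k - i) + m)%N.
  by exists (i - (k - i))%N; rewrite (subnKC (ltnW ji)).
set j := (k - i)%N in ji iE *.
have kE : k = (j + j + m)%N by rewrite -addnA -iE /j subnK.
rewrite iE addKn; case: ifP => [mm1 lti|_ lti].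
  right; exists m; first by rewrite ltnS.
  apply/asboolP; exists j; move: lti.
  rewrite (@eq_bigl _ _ _ _ _ (common_anc (j + m) j x) (cone o j m 0 x)); last first.
    by move=> y; rewrite /cone addn0.
  apply: le_lt_trans.
  rewrite kE exprD; move: (lam * _ / _) c0 => c c0.
  have -> : c * alpha ^+ m * delta ^+ (m1 - m) * b%:R ^+ j =
    (c * alpha ^+ m * delta ^+ (m1 - m)) * b%:R ^+ j by ring.
  have -> : alpha ^+ (j + j) * alpha ^+ m * c * delta ^+ (m1 - m) =
    (c * alpha ^+ m * delta ^+ (m1 - m)) * alpha ^+ (j + j) by ring.
  apply: ler_wpM2l (b_le _); rewrite !mulr_ge0 ?exprn_ge0 ?(ltW d0)//.
have := @sum_desc_le R T o b finite_neighbours nu_le b_gt0 E j (anc o i x).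
move=> /le_lt_trans/(_ lti); rewrite ltNge => /negP[].
rewrite big_mkcond [leRHS]big_mkcond; apply: ler_sum => y _.
rewrite -iE; case: ifP => [/and3P[_ jy /eqP e]|_]; last by case: ifP.
by rewrite /desc jy e eqxx.
Qed.

Lemma card_diag_case m lam X E : 0 < lam ->
  #|` [fset x in X | diag_case m lam E x]|%:R <=
  2 / (lam * (1 - delta) / 4) * #|` E|%:R * theta ^+ m.
Proof.
have [d0 d1 bd1] := delta_bounds.
move: (beta_gt1) (beta_le_alpha) => b1 ba lam0.
have c0 : 0 < lam * (1 - delta) / 4 by rewrite !mulr_gt0//; lra.
have bdm : 0 < (beta * delta) ^+ m by rewrite exprn_gt0//; lra.
have := @cone_maximal_bound R T o b finite_neighbours nu_le b_gt0
  [fset x in X | diag_case m lam E x] E (fun=> 1) 0 m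
  (lam * (1 - delta) / 4 * (alpha * delta) ^+ m).
have cases x : x \in [fset x in X | diag_case m lam E x] -> diag_case m lam E x.
  by rewrite in_fset_cond => /andP[].
move: cases; rewrite /diag_case; move: (lam * _ / _) c0 => c c0 cases.
set X' := [fset x in X | _] in cases *.
have le_bd : (beta * delta) ^+ m <= (alpha * delta) ^+ m.
  have dd0 := ltW d0; have be0 : 0 <= beta by lra.
  have al0 : 0 <= alpha by lra.
  rewrite lerXn2r ?nnegrE ?(mulr_ge0 be0 dd0) ?(mulr_ge0 al0 dd0)//.
  exact: ler_wpM2r.
move=> /(_ (mulr_ge0 (ltW c0) (le_trans (ltW bdm) le_bd)) (fun=> ler01)).
move=> /(_ (fun x xX => elimT (asboolP _) (cases x xX))).
rewrite expr0 mulr1 -(natr_sum _ _ _ (fun=> 1%N)) sum1_size => bound.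
rewrite /theta exprVn ler_pdivlMr//.
have -> : 2 / c * #|` E|%:R = 2 * #|` E|%:R / c by ring.
rewrite ler_pdivlMr//; apply: le_trans bound.
have -> : #|` X'|%:R * (beta * delta) ^+ m * c =
  c * #|` X'|%:R * (beta * delta) ^+ m by ring.
have -> : c * (alpha * delta) ^+ m * #|` X'|%:R =
  c * #|` X'|%:R * (alpha * delta) ^+ m by ring.
by apply: ler_wpM2l le_bd; rewrite mulr_ge0// ltW.
Qed.

(** The factor [b ^+ m] of [cone_maximal_bound], divided by [alpha ^+ m], leaves
    [beta ^+ m], and [beta ^+ m / delta ^+ (m1 - m)] is written relative to its
    largest value, at [m = m1]. *)
Lemma card_antidiag_case m m1 lam X E : 0 < lam -> (m <= m1)%N ->
  #|` [fset x in X | antidiag_case m m1 lam E x]|%:R <=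
  2 / (lam * (1 - delta) / 4) * #|` E|%:R * (beta ^+ m1 * theta ^+ (m1 - m)).
Proof.
have [d0 d1 bd1] := delta_bounds.
move: (beta_gt1) (beta_le_alpha) => b1 ba lam0 mm1.
have c0 : 0 < lam * (1 - delta) / 4 by rewrite !mulr_gt0//; lra.
have am : 0 < alpha ^+ m by rewrite exprn_gt0//; lra.
have bn0 : beta ^+ (m1 - m) != 0 by rewrite expf_neq0// gt_eqF//; lra.
have dm : 0 < delta ^+ (m1 - m) by rewrite exprn_gt0.
have := @cone_maximal_bound R T o b finite_neighbours nu_le b_gt0
  [fset x in X | antidiag_case m m1 lam E x] E (fun=> 1) m 0
  (lam * (1 - delta) / 4 * alpha ^+ m * delta ^+ (m1 - m)).
have cases x : x \in [fset x in X | antidiag_case m m1 lam E x] ->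
    antidiag_case m m1 lam E x.
  by rewrite in_fset_cond => /andP[].
move: cases; rewrite /antidiag_case; move: (lam * _ / _) c0 => c c0 cases.
set X' := [fset x in X | _] in cases *.
move=> /(_ (mulr_ge0 (mulr_ge0 (ltW c0) (ltW am)) (ltW dm)) (fun=> ler01)).
move=> /(_ (fun x xX => elimT (asboolP _) (cases x xX))).
rewrite -(natr_sum _ _ _ (fun=> 1%N)) sum1_size => bound.
have -> : beta ^+ m1 * theta ^+ (m1 - m) = beta ^+ m / delta ^+ (m1 - m).
  by rewrite -{1}(subnKC mm1) exprD /theta exprVn exprMn invfM; field; rewrite bn0 gt_eqF.
have -> : 2 / c * #|` E|%:R * (beta ^+ m / delta ^+ (m1 - m)) =
  2 * #|` E|%:R * beta ^+ m / c / delta ^+ (m1 - m) by ring.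
rewrite ler_pdivlMr// ler_pdivlMr// -(ler_pM2l am).
have -> : alpha ^+ m * (2 * #|` E|%:R * beta ^+ m) = 2 * b%:R ^+ m * #|` E|%:R.
  by rewrite -alpha_beta exprMn; ring.
by apply: le_trans bound; rewrite le_eqVlt; apply/orP; left; apply/eqP; ring.
Qed.

Lemma card_sphere_cases m1 lam X E (k : T -> nat) : 0 < lam ->
  4 * alpha / (alpha - 1) <= lam * alpha ^+ m1 ->
  (forall x, x \in X -> lam * alpha ^+ k x < \sum_(y <- E | dist x y == k x) 1) ->
  #|` X|%:R <= 16 / ((1 - delta) * (1 - theta)) * (lam^-1 * beta ^+ m1) * #|` E|%:R.
Proof.
have [d0 d1 bd1] := delta_bounds.
have th01 : 0 <= theta < 1.
  by rewrite /theta invr_ge0 invf_lt1 ?bd1 ?andbT; lra.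
move: (beta_gt1) => b1 lam0 hm1 H.
pose X1 := [fset x in X | `[< exists2 m, (m < (k x).+1)%N & diag_case m lam E x >]].
pose X2 := [fset x in X | `[< exists2 m, (m < m1.+1)%N & antidiag_case m m1 lam E x >]].
have leX : #|` X|%:R <= #|` X1|%:R + #|` X2|%:R :> R.
  rewrite -natrD ler_nat -cardfsUI (leq_trans _ (leq_addr _ _))//.
  apply/fsubset_leq_card/fsubsetP => x xX; rewrite in_fsetU !in_fset_cond xX /=.
  by apply/orP; case: (sphere_cases (ltW lam0) hm1 (H x xX)) => [?|?];
    [left|right]; apply/asboolP.
set c := 2 / (lam * (1 - delta) / 4) * #|` E|%:R.
have c0 : 0 <= c by rewrite !mulr_ge0 ?invr_ge0 ?mulr_ge0//; lra.
have bm : 1 <= beta ^+ m1 by rewrite exprn_ege1// ltW.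
have le1 : #|` X1|%:R <= c * (1 - theta)^-1.
  pose N := (\max_(x <- X) k x).+1.
  apply: (@le_trans _ _ (\sum_(0 <= m < N) #|` [fset x in X1 | diag_case m lam E x]|%:R)).
    apply: card_cover => x; rewrite in_fset_cond => /andP[xX /asboolP[m mk Pm]].
    by exists m => //; rewrite (leq_trans mk)// ltnS; exact: leq_bigmax_seq.
  apply: le_trans (ler_sum _ (fun m _ => card_diag_case m X1 E lam0)) _.
  by rewrite -mulr_sumr ler_wpM2l// geometric_sum_le.
have le2 : #|` X2|%:R <= c * (beta ^+ m1 * (1 - theta)^-1).
  apply: (@le_trans _ _ (\sum_(0 <= m < m1.+1)
      #|` [fset x in X2 | antidiag_case m m1 lam E x]|%:R)).
    by apply: card_cover => x; rewrite in_fset_cond => /andP[xX /asboolP].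
  apply: (@le_trans _ _ (\sum_(0 <= m < m1.+1) c * (beta ^+ m1 * theta ^+ (m1 - m)))).
    rewrite big_nat [leRHS]big_nat; apply: ler_sum => m /andP[_ mm1].
    exact: card_antidiag_case.
  rewrite -mulr_sumr -mulr_sumr ler_wpM2l// ler_wpM2l//; first lra.
  rewrite big_nat_rev /= add0n.
  rewrite (eq_big_nat _ _ (F2 := fun m => theta ^+ m)) ?geometric_sum_le// => m.
  by move=> /andP[_ mm1]; rewrite subSS subKn.
apply: le_trans leX _; apply: le_trans (lerD le1 le2) _.
have -> : 16 / ((1 - delta) * (1 - theta)) * (lam^-1 * beta ^+ m1) * #|` E|%:R =
   c * (2 * beta ^+ m1 * (1 - theta)^-1).
  by rewrite /c; field; rewrite !subr_eq0 !gt_eqF//; case/andP: th01.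
rewrite -mulrDr ler_wpM2l// -[X in X + _]mul1r -mulrDl ler_wpM2r ?invr_ge0 ?subr_ge0; lra.
Qed.

End Diagonals.

(** * From balls to spheres, and the estimate for sets *)

Lemma powR_exprC (R : realType) (a p : R) n : 0 <= a ->
  (a ^+ n) `^ p = (a `^ p) ^+ n.
Proof. by move=> a0; rewrite -(powR_mulrn n a0) powRAC powR_mulrn ?powR_ge0. Qed.

Lemma expr_unbounded (R : realType) (M a : R) : 1 < a -> exists n, M <= a ^+ n.
Proof.
move=> a1; have bern n : 1 + n%:R * (a - 1) <= a ^+ n.
  elim: n => [|n IH]; first by rewrite mul0r addr0 expr0.
  rewrite exprS -natr1 mulrDl mul1r.
  have : a * (1 + n%:R * (a - 1)) <= a * a ^+ n by apply: ler_wpM2l IH; lra.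
  have : 0 <= n%:R * (a - 1) * (a - 1) by rewrite !mulr_ge0//; lra.
  lra.
have a10 : 0 < a - 1 by lra.
have [n nP] : exists n : nat, `|M| / (a - 1) < n%:R.
  by exists (Num.bound (`|M| / (a - 1))); apply: archi_boundP; rewrite divr_ge0// ltW.
exists n; apply: le_trans (bern n); move: nP; rewrite ltr_pdivrMr// => h.
by have := ler_norm M; lra.
Qed.

Section BallAverages.
Local Open Scope fset_scope.
Local Open Scope ring_scope.
Context {R : realType}.
Variables (T : tree) (b : nat) (alpha C : R).
Hypothesis finite_neighbours : forall x : T, finite_set (neighbours x).
Hypothesis nu_le : forall x : T, (nu x <= b.+1)%N.
Hypothesis b_gt1 : (1 < b)%N.
Hypothesis C_gt0 : 0 < C.
Hypothesis alpha_gt1 : 1 < alpha.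
Hypothesis ball_ge : forall (x : T) r, C * alpha ^+ r <= #|` ballf x r|%:R.
Implicit Types (x y z : T) (X G E : {fset T}) (f : T -> R).

Lemma sum_ball_spheres G f x r : \sum_(y <- G | (dist x y <= r)%N) f y =
  \sum_(0 <= k < r.+1) \sum_(y <- G | dist x y == k) f y.
Proof.
rewrite (exchange_big_dep xpredT) //= big_mkcond; apply: eq_bigr => y _.
case: leqP => yr; last first.
  rewrite big_nat_cond big_pred0// => k; apply/negP => /andP[/andP[_ kr] /eqP e].
  by move: kr yr; rewrite e ltnS ltnNge => ->.
rewrite (eq_bigl (fun k => k == dist x y)); last by move=> k; rewrite eq_sym.
by rewrite big_nat1_eq /= ltnS yr.
Qed.

Definition sphere_const := C * (1 - alpha^-1).

Lemma sphere_const_gt0 : 0 < sphere_const.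
Proof.
move: (alpha_gt1) (C_gt0) => a1 C0.
by rewrite mulr_gt0// subr_gt0 invf_lt1//; lra.
Qed.

Lemma growth_const_le1 : C <= 1.
Proof.
have := ball_ge (point : T) 0; rewrite expr0 mulr1 => /le_trans; apply.
rewrite -[leRHS]/(1%:R) ler_nat card_ballf// big_ord1.
have -> : sphere point 0 = [fset (point : T)]; last by rewrite cardfs1.
apply/fsetP => y; rewrite in_sphere// inE; apply/eqP/eqP => [/dist_eq0|->] //.
exact: distxx.
Qed.

(** The numbers [C * (1 - alpha^-1) * alpha ^ k] with [k <= r] sum to at most
    [C * alpha ^ r], hence to at most the size of the ball. *)
Lemma ball_average_sphere G f x r lam : 0 <= lam ->
  lam * #|` ballf x r|%:R < \sum_(y <- G | (dist x y <= r)%N) f y ->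
  exists k, lam * sphere_const * alpha ^+ k < \sum_(y <- G | dist x y == k) f y.
Proof.
move: (alpha_gt1) => a1 lam0 big.
have ge := ball_ge x r.
have {}big := le_lt_trans (ler_wpM2l lam0 ge) big.
rewrite sum_ball_spheres in big.
suff : \sum_(0 <= k < r.+1) lam * sphere_const * alpha ^+ k <= lam * (C * alpha ^+ r).
  by move=> /le_lt_trans/(_ big)/sum_pigeonhole[k _]; exists k.
rewrite -mulr_sumr /sphere_const -!mulrA ler_wpM2l// ler_wpM2l ?(ltW C_gt0)//.
have a0 : alpha != 0 by rewrite gt_eqF//; lra.
elim: r {big ge} => [|r IH].
  by rewrite big_nat1 expr0 mulr1 gerBl invr_ge0; lra.
rewrite big_nat_recr//= mulrDr (le_trans (lerD IH (lexx _)))//.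
have -> : (1 - alpha^-1) * alpha ^+ r.+1 = alpha ^+ r.+1 - alpha ^+ r.
  by rewrite mulrBl mul1r exprS mulKf.
by rewrite addrC subrK.
Qed.

Lemma sum1_fset E : \sum_(y <- E) (1 : R) = #|` E|%:R.
Proof. by rewrite -(natr_sum _ _ _ (fun=> 1%N)) sum1_size. Qed.

(** Averages of indicator functions do not exceed 1. *)
Lemma level_lt1 E r (lam : R) x : 0 <= lam ->
  lam * #|` ballf x r|%:R < \sum_(y <- E | (dist x y <= r)%N) (1 : R) -> lam < 1.
Proof.
move=> lam0 big; rewrite -(ltr_pM2r (x := #|` ballf x r|%:R)); last first.
  by apply: lt_le_trans (ball_ge x r); rewrite mulr_gt0// exprn_gt0// (lt_trans ltr01).
rewrite mul1r (lt_le_trans big)// -sum1_fset -big_filter.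
apply: ler_sum_uniq => //; rewrite ?filter_uniq ?fset_uniq// => y.
by rewrite mem_filter in_ballf// => /andP[].
Qed.

(** Weak type (p, p) on indicator functions of finite sets, the maximal operator being
    linearized by an arbitrary choice [r] of radii. *)
Definition weak_on_sets (p : R) := exists2 K : R, 0 < K &
  forall lam X E (r : T -> nat), 0 < lam ->
  (forall x, x \in X -> lam * #|` ballf x (r x)|%:R <
                        \sum_(y <- E | (dist x y <= r x)%N) 1) ->
  #|` X|%:R <= K * lam `^ (- p) * #|` E|%:R.

Lemma weak_type_11_balls : alpha = b%:R -> exists2 K : R, 0 < K &
  forall lam X G f (r : T -> nat), 0 < lam -> (forall y, 0 <= f y) ->
  (forall x, x \in X -> lam * #|` ballf x (r x)|%:R <
                        \sum_(y <- G | (dist x y <= r x)%N) f y) ->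
  #|` X|%:R <= K * lam^-1 * \sum_(y <- G) f y.
Proof.
move=> ab; have c0 := sphere_const_gt0.
exists (48 / sphere_const); first by rewrite divr_gt0//; lra.
move=> lam X G f r lam0 f0 H.
have /choice[k kP] x : exists k, x \in X ->
    lam * sphere_const * alpha ^+ k < \sum_(y <- G | dist x y == k) f y.
  have [xX|_] := boolP (x \in X); last by exists 0%N.
  by have [k ?] := ball_average_sphere (ltW lam0) (H x xX); exists k.
have := @weak_type_11_spheres R T b finite_neighbours nu_le G X f k (lam * sphere_const) b_gt1.
rewrite -ab => /(_ (ltW (mulr_gt0 lam0 c0)) f0 kP).
rewrite -ler_pdivlMl ?(mulr_gt0 lam0 c0)// => /le_trans; apply.
by rewrite le_eqVlt; apply/orP; left; apply/eqP; field; rewrite (gt_eqF c0) gt_eqF.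
Qed.

Lemma weak_on_sets_1 : alpha = b%:R -> weak_on_sets 1.
Proof.
move=> /weak_type_11_balls[K K0 H]; exists K => // lam X E r lam0 big.
have := H lam X E (fun=> 1) r lam0 (fun=> ler01) big.
by rewrite sum1_fset powR_inv1// ltW.
Qed.

(** Apply [card_sphere_cases] with the least admissible [m1]. Then [alpha ^+ m1] is of
    order [1 / lam], and [beta ^+ m1] is its power of exponent [p - 1]. *)
Lemma weak_on_sets_gt1 p : 1 < p -> alpha `^ p = b%:R -> b%:R <= alpha ^+ 2 ->
  weak_on_sets p.
Proof.
move: (alpha_gt1) => a1 p1 ap ba2; have c0 := sphere_const_gt0.
have a0 : 0 < alpha by lra.
pose beta := alpha `^ (p - 1).
have ab : alpha * beta = b%:R by rewrite /beta mulr_powRB1 ?ap ?(ltW a0)//; lra.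
have be1 : 1 < beta.
  have := @gt0_ltr_powR R (p - 1); rewrite subr_gt0 => /(_ p1 1 alpha).
  by rewrite powR1 !nnegrE => /(_ ler01 (ltW a0) a1).
have beal : beta <= alpha by rewrite -(ler_pM2l a0) ab -expr2.
have [d0 d1 bd1] := delta_bounds be1 beal.
have th1 : theta beta < 1 by rewrite /theta invf_lt1//; lra.
set D := 16 / ((1 - delta beta) * (1 - theta beta)).
have D0 : 0 < D by rewrite divr_gt0 ?mulr_gt0 ?subr_gt0//; lra.
set A := 4 * alpha / (alpha - 1).
have A4 : 4 <= A by rewrite /A ler_pdivlMr; lra.
set c := sphere_const in c0.
have c1 : c <= 1.
  have ai : 0 <= alpha^-1 by rewrite invr_ge0 ltW.
  have Cle := growth_const_le1; rewrite /c /sphere_const (le_trans _ Cle)// ler_piMr//.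
    exact: ltW.
  by lra.
exists (D * (A * alpha) `^ (p - 1) * c `^ (- p)).
  have Aa0 : 0 < A * alpha by rewrite mulr_gt0//; lra.
  exact: mulr_gt0 (mulr_gt0 D0 (powR_gt0 _ Aa0)) (powR_gt0 _ c0).
move=> lam X E r lam0 H.
have [->|/fset0Pn[x0 x0X]] := eqVneq X fset0.
  by rewrite cardfs0 mulr_ge0// 3?mulr_ge0 ?powR_ge0 ?(ltW D0).
have lam1 := level_lt1 (ltW lam0) (H x0 x0X).
set l := lam * c; have l0 : 0 < l by rewrite mulr_gt0.
have l1 : l <= 1.
  by rewrite /l (le_trans (ler_piMr _ c1)) ?ltW.
have /choice[k kP] x : exists k, x \in X ->
    l * alpha ^+ k < \sum_(y <- E | dist x y == k) 1.
  have [xX|_] := boolP (x \in X); last by exists 0%N.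
  by have [k ?] := ball_average_sphere (ltW lam0) (H x xX); exists k.
have ex_m : exists m, A <= l * alpha ^+ m.
  have [m mP] := expr_unbounded (A / l) a1.
  by exists m; rewrite mulrC -ler_pdivrMr.
have [m mA m_min] := ex_minnP ex_m.
have m_le : l * alpha ^+ m <= A * alpha.
  case: m m_min mA => [|m] m_min mA.
    rewrite expr0 mulr1 (le_trans l1)// (le_trans _ (ler_peMr _ (ltW a1)))//; lra.
  have : ~~ (A <= l * alpha ^+ m) by apply/negP => /m_min; rewrite ltnn.
  by rewrite -ltNge => /ltW h; rewrite exprSr mulrA ler_pM2r.
have := @card_sphere_cases R T b finite_neighbours nu_le (ltnW b_gt1) alpha beta be1
  beal ab m l X E k l0 mA kP.
move=> /le_trans; apply; rewrite -/D ler_wpM2r//.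
clearbody D A; rewrite -!mulrA ler_wpM2l ?(ltW D0)//.
have bm : beta ^+ m = (alpha ^+ m) `^ (p - 1).
  by rewrite powR_exprC ?(ltW a0).
have am0 : 0 < alpha ^+ m by rewrite exprn_gt0.
have : beta ^+ m <= (A * alpha) `^ (p - 1) * l `^ (- (p - 1)).
  rewrite bm powRN ler_pdivlMr ?powR_gt0// -powRM ?(ltW am0) ?(ltW l0)//.
  apply: ge0_ler_powR; rewrite ?nnegrE; first lra.
  - exact: mulr_ge0 (ltW am0) (ltW l0).
  - by apply: mulr_ge0; lra.
  - by rewrite mulrC.
move/(ler_wpM2l (x := l^-1)); rewrite invr_ge0 => /(_ (ltW l0))/le_trans; apply.
have -> : c `^ (- p) * lam `^ (- p) = l `^ (- p) by rewrite -powRM ?(ltW c0) ?(ltW lam0)// mulrC.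
have -> : l `^ (- p) = l^-1 * l `^ (- (p - 1)).
  rewrite -(powR_inv1 (ltW l0)) -powRD; last by rewrite (gt_eqF l0) implybT.
  by have -> : -1 + - (p - 1) = - p by ring.
by rewrite le_eqVlt; apply/orP; left; apply/eqP; ring.
Qed.

(** Balls have at most [4 * b ^ r] points, so [(alpha / b) ^ r] is bounded in [r]. *)
Lemma alpha_le_b : alpha <= b%:R.
Proof.
move: (alpha_gt1) => a1; rewrite leNgt; apply/negP => ltba.
have b0 : 0 < b%:R :> R by rewrite ltr0n ltnW.
have q1 : 1 < alpha / b%:R by rewrite ltr_pdivlMr ?mul1r.
have [r rP] := expr_unbounded (5 / C) q1.
have br : 0 < b%:R ^+ r :> R by rewrite exprn_gt0.
have : C * alpha ^+ r <= 4 * b%:R ^+ r.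
  rewrite (le_trans (ball_ge point r))// card_ballf// natr_sum.
  apply: (@le_trans _ _ (\sum_(k < r.+1) 2 * b%:R ^+ k : R)).
    apply: ler_sum => k _; rewrite -natrX -natrM ler_nat.
    by rewrite card_sphere_le// ltnW.
  rewrite -mulr_sumr (le_trans (ler_wpM2l _ (sum_geom_nat _ b_gt1)))//.
  by rewrite mulrA -natrM.
rewrite -ler_pdivrMr// -mulrA -expr_div_n => le4.
move: rP; rewrite ler_pdivrMr// mulrC; lra.
Qed.

End BallAverages.

(** * From weak type to a bilinear bound *)

Section Kolmogorov.
Local Open Scope fset_scope.
Local Open Scope ring_scope.
Context {R : realType}.

(** Young's inequality for [t `^ s] and [1] with exponents [1 / s] and [1 / (1 - s)]. *)
Lemma powR_le_tangent (s t : R) : 0 < s < 1 -> 0 <= t -> t `^ s <= 1 + s * (t - 1).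
Proof.
move=> /andP[s0 s1] t0; have s1' : 0 < 1 - s by lra.
have := @conjugate_powR R (t `^ s) 1 s^-1 (1 - s)^-1 (powR_ge0 _ _) ler01.
rewrite !invr_gt0 !invrK => /(_ s0 s1').
rewrite (_ : s + (1 - s) = 1); last by ring.
move=> /(_ erefl); rewrite -powRrM divff ?gt_eqF// powRr1// powR1 mulr1; lra.
Qed.

Lemma powR_natS_ge (s : R) n : 0 < s < 1 ->
  n%:R `^ s + s * n.+1%:R `^ (s - 1) <= n.+1%:R `^ s.
Proof.
move=> s01; have /andP[s0 s1] := s01.
have n0 : 0 < n.+1%:R :> R by rewrite ltr0n.
have t0 : 0 <= n%:R / n.+1%:R :> R by rewrite divr_ge0.
have := powR_le_tangent s01 t0.
have -> : n%:R / n.+1%:R - 1 = - n.+1%:R^-1 :> R.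
  by rewrite -[n.+1%:R]natr1; field; rewrite natr1 gt_eqF.
have P0 : 0 < n.+1%:R `^ s :> R by rewrite powR_gt0.
move=> /(ler_wpM2l (ltW P0)).
rewrite -powRM// ?divr_ge0// mulrCA divff ?gt_eqF// mulr1.
have -> : n.+1%:R `^ (s - 1) = n.+1%:R `^ s / n.+1%:R :> R.
  by rewrite powRB ?powRr1 ?(gt_eqF n0) ?implybT.
by move: (n.+1%:R `^ s) (n.+1%:R^-1) => P v; lra.
Qed.

(** Remove from [X] a point [x1] where [g] is least. All of [X] lies in the superlevel sets
    of [g] below [g x1], so [#|X| <= A * g x1 `^ (- p)], which bounds [g x1]. By
    induction the sum is at most [A `^ (1 / p)] times the sum of [n `^ (- 1 / p)],
    which [powR_natS_ge] compares with a telescoping sum. *)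
Lemma sum_le_of_weak (K : choiceType) (p : R) (X : {fset K}) (g : K -> R) (A : R) :
  1 < p -> 0 <= A ->
  (forall (lam : R) (Y : {fset K}), 0 < lam -> Y `<=` X ->
     (forall x, x \in Y -> lam < g x) -> #|` Y|%:R <= A * lam `^ (- p)) ->
  \sum_(x <- X) g x <= (1 - p^-1)^-1 * A `^ p^-1 * #|` X|%:R `^ (1 - p^-1).
Proof.
move=> p1 A0; have p0 : 0 < p by lra.
set s := 1 - p^-1.
have s01 : 0 < s < 1.
  have : 0 < p^-1 < 1 by rewrite invr_gt0 p0 invf_lt1.
  by rewrite /s; lra.
have /andP[s0 s1] := s01.
move nX : #|` X| => n; elim: n X nX => [|n IH] X nX weak.
  move/cardfs0_eq: nX => ->; rewrite big_seq_fset0.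
  by rewrite !mulr_ge0 ?powR_ge0 ?invr_ge0 ?ltW.
have [x0 x0X] : exists x, x \in X by apply/fset0Pn; rewrite -cardfs_gt0 nX.
have [x1 x1X x1_min] : exists2 x1, x1 \in X & forall x, x \in X -> g x1 <= g x.
  pose i := [arg min_(i < [` x0X]) g (val i)]%O.
  exists (val i); first exact: valP.
  move=> x xX; rewrite /i; case: arg_minP => // j _ /(_ [` xX]); exact.
have cX : #|` X `\ x1| = n by have := cardfsD1 x1 X; rewrite x1X nX; lia.
have := IH _ cX; move/(_ _)/wrap; case.
  move=> lam Y lam0 YX; apply: weak => //; apply: fsubset_trans YX _.
  exact: fsubD1set.
move=> IHn; rewrite (big_fsetD1 x1)//=.
have min_le : g x1 <= A `^ p^-1 * n.+1%:R `^ (s - 1).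
  have -> : s - 1 = - p^-1 by rewrite /s; ring.
  have [|gpos] := leP (g x1) 0.
    by move=> /le_trans; apply; rewrite mulr_ge0 ?powR_ge0.
  have n0 : 0 < n.+1%:R :> R by rewrite ltr0n.
  rewrite leNgt; apply/negP => lt_g.
  set l := A `^ p^-1 * n.+1%:R `^ (- p^-1) in lt_g.
  have l0 : 0 <= l by rewrite mulr_ge0 ?powR_ge0.
  have lp : l `^ p = A / n.+1%:R.
    rewrite powRM ?powR_ge0// -!powRrM mulNr mulVf ?gt_eqF// powRr1//.
    by rewrite powR_inv1// ltW.
  (* A level strictly between l and g x1, so that X lies above it. *)
  pose m := (l + g x1) / 2.
  have m0 : 0 < m by rewrite /m; lra.
  have := weak m X m0 (fsubset_refl _).
  have lt_m x : x \in X -> m < g x by move=> /x1_min; rewrite /m; lra.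
  rewrite nX powRN => /(_ lt_m); rewrite ler_pdivlMr ?powR_gt0//.
  rewrite leNgt => /negP; apply.
  rewrite -ltr_pdivrMl// mulrC -lp; have := @gt0_ltr_powR R p p0 l m.
  by rewrite !nnegrE => -> //; rewrite /m; lra.
apply: le_trans (lerD min_le IHn) _.
have := powR_natS_ge n s01.
have a0 : 0 <= s^-1 * A `^ p^-1 by rewrite mulr_ge0 ?powR_ge0 ?invr_ge0 ?ltW.
move=> /(ler_wpM2l a0); apply: le_trans.
rewrite mulrDr addrC lerD2l le_eqVlt; apply/orP; left; apply/eqP.
by field; rewrite gt_eqF.
Qed.

End Kolmogorov.

Section RestrictedBilinear.
Local Open Scope fset_scope.
Local Open Scope ring_scope.
Context {R : realType}.
Variable T : tree.
Hypothesis finite_neighbours : forall x : T, finite_set (neighbours x).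
Implicit Types (X E : {fset T}).

Lemma card_ballf_gt0 (x : T) r : 0 < #|` ballf x r|%:R :> R.
Proof.
rewrite ltr0n cardfs_gt0; apply/fset0Pn; exists x.
by rewrite in_ballf// distxx.
Qed.

Lemma restricted_bilinear p : 1 < p -> weak_on_sets T p ->
  exists2 K : R, 0 < K & forall X E (r : T -> nat),
   \sum_(x <- X) (\sum_(y <- E | (dist x y <= r x)%N) 1) / #|` ballf x (r x)|%:R
     <= K * #|` E|%:R `^ p^-1 * #|` X|%:R `^ (1 - p^-1).
Proof.
move=> p1 [K K0 weak].
have p0 : 0 < p by lra.
have s0 : 0 < 1 - p^-1 by rewrite subr_gt0 invf_lt1.
exists ((1 - p^-1)^-1 * K `^ p^-1); first by rewrite mulr_gt0 ?powR_gt0 ?invr_gt0.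
move=> X E r.
have := @sum_le_of_weak R T p X (fun x =>
  (\sum_(y <- E | (dist x y <= r x)%N) 1) / #|` ballf x (r x)|%:R) (K * #|` E|%:R) p1.
rewrite mulr_ge0 ?(ltW K0)// => /(_ isT).
move=> /(_ _)/wrap[lam Y lam0 _ H|/le_trans]; last first.
  by apply; rewrite powRM ?(ltW K0)// mulrA.
rewrite mulrAC; apply: (weak lam Y E r lam0) => x /H.
by rewrite ltr_pdivlMr ?card_ballf_gt0.
Qed.

End RestrictedBilinear.

(** * Interpolation with the bound on bounded functions *)

Section Dyadic.
Local Open Scope fset_scope.
Local Open Scope ring_scope.
Context {R : realType}.

Lemma powR_dyadic (p s : R) m : 0 <= s ->
  (s * 2 ^+ m) `^ p = s `^ p * (2 `^ p) ^+ m.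
Proof. by move=> s0; rewrite powRM ?exprn_ge0// powR_exprC. Qed.

Lemma dyadic_powR_sum_le (p s t : R) n : 0 < p -> 0 <= s -> 0 <= t ->
  \sum_(0 <= m < n | s * 2 ^+ m < t) (s * 2 ^+ m) `^ p <=
  (1 - 2 `^ (- p))^-1 * t `^ p.
Proof.
move=> p0 s0 t0.
have P1 : 1 < 2 `^ p.
  by have := @gt0_ltr_powR R p p0 1 2; rewrite powR1 !nnegrE; apply; lra.
set D := (1 - 2 `^ (- p))^-1.
have D0 : 0 < D by rewrite invr_gt0 subr_gt0 powRN invf_lt1//; lra.
have DE : D * (2 `^ p - 1) = 2 `^ p.
  rewrite /D powRN; field; rewrite subr_eq0 gt_eqF//=; lra.
have full k : \sum_(0 <= m < k.+1) (s * 2 ^+ m) `^ p <= D * (s * 2 ^+ k) `^ p.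
  elim: k => [|k IH].
    rewrite big_nat1 ler_peMl ?powR_ge0// -(ler_pM2r (x := 2 `^ p - 1)) ?DE; lra.
  rewrite big_nat_recr//= (le_trans (lerD IH (lexx _)))// !powR_dyadic// exprS.
  have : 0 <= s `^ p * (2 `^ p) ^+ k by rewrite mulr_ge0 ?powR_ge0// exprn_ge0 ?powR_ge0.
  move: (s `^ p) ((2 `^ p) ^+ k) => S Q SQ.
  have -> : D * (S * (2 `^ p * Q)) = D * (S * Q) + (D * (2 `^ p - 1)) * (S * Q) by ring.
  by rewrite DE; lra.
elim: n => [|n IH]; first by rewrite big_geq// mulr_ge0 ?powR_ge0 ?(ltW D0).
have [ltn|ltn] := boolP (s * 2 ^+ n < t); last first.
  by rewrite big_mkcond big_nat_recr//= (negPf ltn) addr0 -big_mkcond.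
apply: le_trans (le_trans (full n) _); last first.
  rewrite ler_wpM2l ?(ltW D0)// ge0_ler_powR ?nnegrE ?(ltW ltn) ?(ltW p0)//.
  by rewrite mulr_ge0 ?exprn_ge0.
rewrite big_mkcond; apply: ler_sum => m _; case: ifP => // _.
exact: powR_ge0.
Qed.

(** If [s * 2 ^ (n - 1) < t], the last index [m] with [s * 2 ^ m < 2 * t] has
    [t <= s * 2 ^ m], and that layer alone suffices; otherwise the first term does. *)
Lemma dyadic_layers_ge (s t : R) n N : 0 <= s -> (n <= N)%N -> t <= s * 2 ^+ N ->
  t <= s * 2 ^+ n / 2 +
    \sum_(n <= m < N.+1 | s * 2 ^+ m < 2 * t) s * 2 ^+ m.
Proof.
move=> s0; elim: N => [|N IH] nN tN.
  move: nN tN; rewrite leqn0 => /eqP -> tN.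
  rewrite big_mkcond big_nat1; case: ltP => h; rewrite expr0 mulr1 in h tN *; lra.
have sn k : 0 <= s * 2 ^+ k by rewrite mulr_ge0// exprn_ge0.
rewrite big_mkcond big_nat_recr//= -big_mkcond /=.
case: ltP => h.
  apply: le_trans tN _; rewrite addrA lerDr addr_ge0 ?divr_ge0// sumr_ge0//.
rewrite addr0; move: nN; rewrite leq_eqVlt => /orP[/eqP nE|]; last first.
  rewrite ltnS => nN; apply: IH => //.
  by move: h; rewrite exprS; lra.
apply: (@le_trans _ _ (s * 2 ^+ n / 2)); first by rewrite nE; lra.
by rewrite lerDl sumr_ge0.
Qed.

End Dyadic.

Section Interpolation.
Local Open Scope fset_scope.
Local Open Scope ring_scope.
Context {R : realType}.
Variable T : tree.
Hypothesis finite_neighbours : forall x : T, finite_set (neighbours x).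
Implicit Types (X G : {fset T}) (f : T -> R).

(** Let [v x] be of size [s * 2 ^ n], and split [f] into a part of size at most
    [s * 2 ^ n / 2], which contributes at most half of the average, and the layers
    [s * 2 ^ m] with [n <= m]. Some layer [E m] has an average above
    [l0 * (q / 2) ^ (m - n)], and the estimate for sets bounds the number of these [x].
    As [q < 1] is close enough to 1, the sum over [n <= m] converges geometrically, and
    the sum over [m] of [(s * 2 ^ m) `^ p * #|E m|] is comparable to the sum of
    [f y `^ p]. *)
Lemma strong_of_weak_on_sets (p0 p : R) : 0 < p0 -> p0 < p -> weak_on_sets T p0 ->
  exists2 K : R, 0 < K & forall X G f (r : T -> nat) (v : T -> R),
    (forall y, 0 <= f y) ->
    (forall x, x \in X -> 0 < v x /\
       v x * #|` ballf x (r x)|%:R < \sum_(y <- G | (dist x y <= r x)%N) f y) ->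
    \sum_(x <- X) v x `^ p <= K * \sum_(y <- G) f y `^ p.
Proof.
move=> p00 p0p [K K0 weak]; have pp : 0 < p by lra.
pose e := (p - p0) / 2.
have e0 : 0 < e by rewrite /e; lra.
(* q `^ p0 = 2 `^ (- e) lies strictly between 2 `^ (p0 - p) and 1, so that the ratio
   rho of the final geometric series is less than 1. *)
pose q : R := 2 `^ (- (e / p0)).
have q0 : 0 < q by rewrite powR_gt0.
have q1 : q < 1.
  rewrite /q powRN invf_lt1 ?powR_gt0//.
  have := @gt0_ltr_powR R (e / p0); rewrite divr_gt0// => /(_ isT 1 2).
  by rewrite powR1 !nnegrE; apply; lra.
pose l0 := (1 - q) / 2.
have l00 : 0 < l0 by rewrite /l0; lra.
pose P : R := 2 `^ p.
have P1 : 0 < P by rewrite powR_gt0.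
pose Q := (q / 2) `^ (- p0).
have Q0 : 0 < Q by rewrite powR_gt0// divr_gt0.
pose rho := 2 `^ (- e) : R.
have QE : Q = P * rho.
  rewrite /Q powRM ?invr_ge0 ?(ltW q0)// -powRrM mulrNN divfK ?gt_eqF//.
  rewrite -powR_inv1// -powRrM mulrNN mul1r /P /rho -!powRD; try by rewrite pnatr_eq0 implybT.
  by have -> : e + p0 = p + - e by rewrite /e; field.
have rho0 : 0 < rho by rewrite powR_gt0.
have rho1 : rho < 1.
  rewrite /rho powRN invf_lt1 ?powR_gt0//.
  by have := @gt0_ltr_powR R e e0 1 2; rewrite powR1 !nnegrE; apply; lra.
set D := (1 - 2 `^ (- p))^-1.
have D0 : 0 < D.
  rewrite invr_gt0 subr_gt0 powRN invf_lt1 ?powR_gt0//.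
  by have := @gt0_ltr_powR R p pp 1 2; rewrite powR1 !nnegrE; apply; lra.
pose M := K * l0 `^ (- p0) * P * (1 - rho)^-1.
have M0 : 0 < M.
  apply: mulr_gt0; last by rewrite invr_gt0 subr_gt0.
  by apply: mulr_gt0 => //; apply: mulr_gt0 => //; exact: powR_gt0.
exists (M * (D * 2 `^ p)); first exact: mulr_gt0 M0 (mulr_gt0 D0 P1).
move=> X G f r v f0 H.
have [->|/fset0Pn[x0 x0X]] := eqVneq X fset0.
  rewrite big_seq_fset0 mulr_ge0 ?sumr_ge0// => [|y _]; last exact: powR_ge0.
  by rewrite mulr_ge0 ?(ltW M0)// mulr_ge0 ?powR_ge0// ltW.
have [s s0 sv] : exists2 s : R, 0 < s & forall x, x \in X -> s <= v x.
  pose i := [arg min_(i < [` x0X]) v (val i)]%O.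
  exists (v (val i)); first by have [] := H (val i) (valP i).
  move=> x xX; rewrite /i; case: arg_minP => // j _ /(_ [` xX]); exact.
(* s is below all the v x, and s * 2 ^+ N is above all the v x and all the f y:
   only finitely many dyadic levels occur. *)
pose B := \sum_(x <- X) v x + \sum_(y <- G) f y.
have [N NB] : exists N, B / s <= 2 ^+ N by apply: expr_unbounded; lra.
have v0 x : x \in X -> 0 <= v x by move=> /H[/ltW].
have sumv0 : 0 <= \sum_(x <- X) v x by rewrite big_seq sumr_ge0.
have sumf0 : 0 <= \sum_(y <- G) f y by rewrite sumr_ge0.
have vN x : x \in X -> v x <= s * 2 ^+ N.
  move=> xX; rewrite -ler_pdivrMl// mulrC (le_trans _ NB)//.
  rewrite ler_pM2r ?invr_gt0// /B (big_fsetD1 x)//= -addrA lerDl addr_ge0//.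
  by rewrite big_seq sumr_ge0// => y; rewrite in_fsetD1 => /andP[_ /v0].
have fN y : y \in G -> f y <= s * 2 ^+ N.
  move=> yG; rewrite -ler_pdivrMl// mulrC (le_trans _ NB)//.
  rewrite ler_pM2r ?invr_gt0// /B (big_fsetD1 y yG)//= addrCA lerDl addr_ge0//.
  by rewrite sumr_ge0.
pose E m := [fset y in G | s * 2 ^+ m < 2 * f y].
have choose x : exists nm : nat * nat, x \in X ->
   [/\ (nm.1 <= nm.2 < N.+1)%N, v x <= s * 2 ^+ nm.1.+1 &
      l0 * (q / 2) ^+ (nm.2 - nm.1) * #|` ballf x (r x)|%:R <
      \sum_(y <- E nm.2 | (dist x y <= r x)%N) 1].
  have [xX|_] := boolP (x \in X); last by exists (0, 0)%N.
  have [vx0 big] := H x xX.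
  have exn : exists n, (n <= N)%N && (s * 2 ^+ n <= v x).
    by exists 0%N; rewrite leq0n expr0 mulr1 sv.
  have bn n : (n <= N)%N && (s * 2 ^+ n <= v x) -> (n <= N)%N by case/andP.
  have [n /andP[nN ln] n_max] := ex_maxnP exn bn.
  have vn : v x <= s * 2 ^+ n.+1.
    have [Nn|Nn] := leqP N n.
      apply: (le_trans (vN x xX)); apply: ler_wpM2l; first exact: ltW.
      by apply: ler_weXn2l; [rewrite ler1n | exact: leqW].
    rewrite leNgt; apply/negP => /ltW ltv.
    by have := n_max n.+1; rewrite Nn ltv ltnn => /(_ isT).
  set b := #|` ballf x (r x)|%:R in big *.
  have b0 : 0 < b by exact: card_ballf_gt0.
  have card_le : \sum_(y <- G | (dist x y <= r x)%N) (1 : R) <= b.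
    rewrite /b -sum1_fset -big_filter.
    apply: ler_sum_uniq => //; rewrite ?filter_uniq ?fset_uniq// => y.
    by rewrite mem_filter in_ballf// => /andP[].
  have split_f : \sum_(y <- G | (dist x y <= r x)%N) f y <=
     s * 2 ^+ n / 2 * b + \sum_(n <= m < N.+1) s * 2 ^+ m *
        \sum_(y <- E m | (dist x y <= r x)%N) 1.
    apply: (@le_trans _ _ (\sum_(y <- G | (dist x y <= r x)%N)
      (s * 2 ^+ n / 2 + \sum_(n <= m < N.+1 | s * 2 ^+ m < 2 * f y) s * 2 ^+ m))).
      rewrite big_seq_cond [leRHS]big_seq_cond; apply: ler_sum => y /andP[yG _].
      exact: dyadic_layers_ge (ltW s0) nN (fN y yG).
    rewrite big_split /= lerD//.
      rewrite -[X in \sum_(_ <- _ | _) X]mulr1 -mulr_sumr ler_wpM2l//.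
      by rewrite divr_ge0// mulr_ge0 ?exprn_ge0 ?ltW.
    rewrite (exchange_big_dep xpredT) //=; apply: ler_sum => m _.
    rewrite -[X in \sum_(_ <- _ | _) X <= _]mulr1 -mulr_sumr.
    rewrite ler_wpM2l ?mulr_ge0 ?exprn_ge0 ?(ltW s0)//.
    rewrite -big_filter -[leLHS]big_filter.
    apply: ler_sum_uniq; rewrite ?filter_uniq ?fset_uniq// => y.
    by rewrite !mem_filter in_fset_cond => /andP[/andP[-> ->] ->].
  have geo : \sum_(n <= m < N.+1) s * 2 ^+ n / 2 * b * (1 - q) * q ^+ (m - n) <=
      s * 2 ^+ n / 2 * b.
    rewrite -mulr_sumr -[leRHS]mulr1 -mulrA.
    rewrite ler_wpM2l ?mulr_ge0 ?exprn_ge0 ?invr_ge0 ?(ltW s0) ?(ltW b0)//.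
    rewrite -ler_pdivlMl ?subr_gt0// mulr1.
    rewrite -{1}(add0n n) big_addn (eq_bigr (fun m => q ^+ m)) => [|m _]; last by rewrite addnK.
    by rewrite geometric_sum_le// (ltW q0).
  have lt_sum : \sum_(n <= m < N.+1) s * 2 ^+ n / 2 * b * (1 - q) * q ^+ (m - n) <
     \sum_(n <= m < N.+1) s * 2 ^+ m * \sum_(y <- E m | (dist x y <= r x)%N) 1.
    have := ler_wpM2r (ltW b0) ln; lra.
  have [m] := sum_pigeonhole lt_sum; rewrite mem_index_iota => nm lt_m.
  exists (n, m); split => //=.
  have sm0 : 0 < s * 2 ^+ m by rewrite mulr_gt0 ?exprn_gt0.
  rewrite -(ltr_pM2l sm0); apply: le_lt_trans lt_m.
  have -> : 2 ^+ m = 2 ^+ n * 2 ^+ (m - n) :> R.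
    by rewrite -exprD subnKC//; case/andP: nm.
  rewrite /l0 expr_div_n le_eqVlt; apply/orP; left; apply/eqP.
  by field; rewrite expf_neq0.
have [nm nmP] := choice choose.
have stepX : \sum_(x <- X) v x `^ p <= \sum_(0 <= m < N.+1) \sum_(0 <= n < m.+1)
    (s * 2 ^+ n.+1) `^ p * \sum_(x <- X | nm x == (n, m)) 1.
  apply: (@le_trans _ _ (\sum_(x <- X) (s * 2 ^+ (nm x).1.+1) `^ p)).
    rewrite big_seq [leRHS]big_seq; apply: ler_sum => x xX.
    have [_ h _] := nmP x xX; apply: ge0_ler_powR; rewrite ?nnegrE ?(ltW pp) ?v0//.
    by rewrite mulr_ge0 ?exprn_ge0 ?ltW.
  apply: (@le_trans _ _ (\sum_(x <- X) \sum_(0 <= m < N.+1) \sum_(0 <= n < m.+1)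
    (if nm x == (n, m) then (s * 2 ^+ n.+1) `^ p else 0))).
    rewrite big_seq [leRHS]big_seq; apply: ler_sum => x xX.
    have [/andP[n_m m_N] _ _] := nmP x xX.
    rewrite (@big_rem _ _ _ _ _ (nm x).2) ?mem_index_iota//=.
    rewrite (@big_rem _ _ _ _ _ (nm x).1) ?mem_index_iota//=.
    rewrite -surjective_pairing eqxx -addrA lerDl addr_ge0 ?sumr_ge0// => i _.
      by case: ifP => // _; exact: powR_ge0.
    by rewrite sumr_ge0// => j _; case: ifP => // _; exact: powR_ge0.
  rewrite exchange_big; apply: ler_sum => m _.
  rewrite exchange_big; apply: ler_sum => n _.
  by rewrite -big_mkcond /= mulr_sumr mulr1.
apply: le_trans stepX _.
have stepY m n : (n < m.+1)%N -> (s * 2 ^+ n.+1) `^ p * \sum_(x <- X | nm x == (n, m)) 1 <=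
   (K * l0 `^ (- p0) * P) * ((s * 2 ^+ m) `^ p * #|` E m|%:R) * rho ^+ (m - n).
  move=> nlem.
  pose Y := [fset x in X | nm x == (n, m)].
  have -> : \sum_(x <- X | nm x == (n, m)) 1 = #|` Y|%:R :> R.
    rewrite -sum1_fset -big_filter; apply: perm_big; apply: uniq_perm.
    - by rewrite filter_uniq.
    - exact: fset_uniq.
    - by move=> x; rewrite mem_filter in_fset_cond andbC.
  have lam0 : 0 < l0 * (q / 2) ^+ (m - n) by rewrite mulr_gt0// exprn_gt0// divr_gt0.
  have := weak _ Y (E m) r lam0.
  move=> /(_ _)/wrap[x|le_Y].
    by rewrite in_fset_cond => /andP[xX /eqP e1]; have [_ _] := nmP x xX; rewrite e1.
  apply: le_trans (ler_wpM2l (powR_ge0 _ _) le_Y) _.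
  have -> : (l0 * (q / 2) ^+ (m - n)) `^ (- p0) = l0 `^ (- p0) * Q ^+ (m - n).
    by rewrite powRM ?(ltW l00) ?exprn_ge0 ?divr_ge0 ?(ltW q0)// powR_exprC ?divr_ge0 ?(ltW q0).
  rewrite !powR_dyadic ?(ltW s0)// -/P QE exprMn.
  have -> : P ^+ m = P ^+ (m - n) * P ^+ n by rewrite -exprD subnK.
  by rewrite exprS le_eqVlt; apply/orP; left; apply/eqP; ring.
apply: (@le_trans _ _ (\sum_(0 <= m < N.+1) M * ((s * 2 ^+ m) `^ p * #|` E m|%:R))).
  apply: ler_sum => m _.
  apply: (@le_trans _ _ (\sum_(0 <= n < m.+1)
    (K * l0 `^ (- p0) * P) * ((s * 2 ^+ m) `^ p * #|` E m|%:R) * rho ^+ (m - n))).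
    rewrite big_nat [leRHS]big_nat; apply: ler_sum => n /andP[_ nm']; exact: stepY.
  rewrite -mulr_sumr /M [leRHS]mulrAC ler_wpM2l//.
    apply: mulr_ge0; last by rewrite mulr_ge0 ?powR_ge0.
    by apply: mulr_ge0; [apply: mulr_ge0; [exact: ltW | exact: powR_ge0] | exact: ltW].
  rewrite big_nat_rev /= add0n.
  rewrite (eq_big_nat _ _ (F2 := fun i => rho ^+ i)) ?geometric_sum_le ?(ltW rho0)//.
  by move=> i /andP[_ im]; rewrite subSS subKn.
rewrite -mulr_sumr -mulrA ler_wpM2l ?(ltW M0)//.
apply: (@le_trans _ _ (\sum_(y <- G) \sum_(0 <= m < N.+1 | s * 2 ^+ m < 2 * f y)
    (s * 2 ^+ m) `^ p)).
  rewrite (exchange_big_dep xpredT) //=; apply: ler_sum => m _.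
  rewrite -sum1_fset mulr_sumr mulr1.
  rewrite -[leRHS]big_filter; apply: ler_sum_uniq; rewrite ?filter_uniq ?fset_uniq//.
    by move=> y; rewrite mem_filter in_fset_cond andbC.
  by move=> _; exact: powR_ge0.
rewrite mulr_sumr; apply: ler_sum => y _.
apply: le_trans (dyadic_powR_sum_le _ pp (ltW s0) _) _; first by rewrite mulr_ge0.
by rewrite powRM// -/D mulrA.
Qed.

End Interpolation.

(** * Integrals as finite sums *)

(** The integral of a nonnegative function is the supremum of the integrals of the
    simple functions below it, so it increases with the function. The upper function
    will be [t |-> |E_f(t)| `^ (1 / p)], which is known through lower bounds only. *)
Lemma ge0_le_integral_of_le d (S : measurableType d) (R : realType)
    (nu : {measure set S -> \bar R}) (D : set S) (f g : S -> \bar R) :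
  (forall x, D x -> (0 <= f x)%E) -> (forall x, D x -> (f x <= g x)%E) ->
  (\int[nu]_(x in D) f x <= \int[nu]_(x in D) g x)%E.
Proof.
move=> f0 fg; have g0 x : D x -> (0 <= g x)%E.
  by move=> Dx; apply: le_trans (fg x Dx); exact: f0.
rewrite !ge0_integralE//; apply: ereal_sup_le => _ [h hf <-]; exists h => // x.
by apply: le_trans (hf x) _; exact: lee_restrict.
Qed.

Section Layers.
Context {R : realType}.
Local Open Scope ereal_scope.

(** Write [g y] as the length of the interval of all [t] with [0 < t < g y] and exchange
    the sum over [y] with the integral over [t]. *)
Lemma layer_cake_le (K : choiceType) (G : {fset K}) (w g : K -> R) (S : R -> \bar R) :
  (forall y, (0 <= w y)%R) -> (forall y, (0 <= g y)%R) ->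
  (forall t : R, (0 < t)%R -> (\sum_(y <- G | (t < g y)%R) w y)%:E <= S t) ->
  (\sum_(y <- G) w y * g y)%:E <=
  \int[lebesgue_measure]_(t in `]0%R, +oo[) S t.
Proof.
move=> w0 g0 wS.
have mI : measurable (`]0%R, +oo[ : set R) by exact: measurable_itv.
have mA y : measurable (`]-oo, g y[ : set R) by exact: measurable_itv.
apply: (@le_trans _ _ (\int[lebesgue_measure]_(t in `]0%R, +oo[)
    (\sum_(y <- G) (w y)%:E * (\1_(`]-oo, g y[) t)%:E))); last first.
  apply: ge0_le_integral_of_le => t /=; rewrite in_itv/= andbT => t0.
    by apply: sume_ge0 => y _; rewrite mule_ge0// lee_fin.
  apply: le_trans (wS t t0); rewrite [X in X%:E]big_mkcond -sumEFin.
  apply: lee_sum => y _.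
  rewrite indicE -EFinM lee_fin; case: ifPn => ty.
    by rewrite mem_set ?mulr1//= in_itv.
  by rewrite memNset ?mulr0//= in_itv/=; exact/negP.
rewrite ge0_integral_sum//; last 2 first.
  - move=> y; apply: measurable_funeM; apply/measurable_EFinP.
    exact: measurable_indic.
  - by move=> y t _; rewrite mule_ge0// lee_fin.
rewrite -sumEFin; apply: lee_sum => y _.
rewrite ge0_integralZl_EFin//; last first.
  by apply/measurable_EFinP; exact: measurable_indic.
rewrite integral_indic// EFinM lee_wpmul2l ?lee_fin//.
have -> : `]-oo, g y[%classic `&` `]0%R, +oo[%classic = `]0%R, g y[%classic.
  by apply/seteqP; split => t /=; rewrite !in_itv/= andbT;
    [move=> [-> ->]|move=> /andP[-> ->]].
rewrite [leRHS](@lebesgue_measure_itv R `]0%R, g y[)/= lte_fin; case: ltP => [_|gy0].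
  by rewrite sube0.
by rewrite lee_fin.
Qed.

End Layers.

Section TreeIntegrals.
Context {R : realType} {T : tree}.
Local Open Scope ereal_scope.
Local Notation mu := (@counting T R).
Hypothesis finite_neighbours : forall x : T, finite_set (neighbours x).
Implicit Types (X : {fset T}) (g : T -> \bar R).

Lemma measurable_vertices (A : set T) : measurable A.
Proof. by []. Qed.

Lemma measurable_fun_vertices (D : set T) g : measurable_fun D g.
Proof. by move=> _ B _; exact: measurable_vertices. Qed.

Lemma integral_fset X g : (forall x, 0 <= g x) ->
  \int[mu]_(y in [set` X]) g y = \sum_(y <- X) g y.
Proof.
move=> g0.
have -> : [set` X] = \big[setU/set0]_(i <- X) [set i].
  by rewrite -bigcup_seq bigcup_imset1 image_id.
rewrite ge0_integral_bigsetU//; last by move=> i j _ _ [y [/= -> ->]].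
apply: eq_bigr => i _.
rewrite (eq_integral (cst (g i))); last by move=> x /set_mem ->.
rewrite integral_cst// [X in _ * X](_ : _ = 1) ?mule1//.
by rewrite /= /counting asboolT// fset_set1 cardfs1.
Qed.

Lemma sum_le_integral X g : (forall x, 0 <= g x) ->
  \sum_(y <- X) g y <= \int[mu]_y g y.
Proof.
move=> g0; rewrite -integral_fset//.
by apply: ge0_subset_integral => //; exact: measurable_fun_vertices.
Qed.

(** The balls around a vertex exhaust the tree, and each of them is finite. *)
Lemma integral_le_of_sums g M : (forall x, 0 <= g x) ->
  (forall X, \sum_(y <- X) g y <= M) -> \int[mu]_y g y <= M.
Proof.
move=> g0 H.
have -> : [set: T] = \bigcup_n tball (point : T) n.
  apply/seteqP; split => // y _; exists (dist (point : T) y) => //.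
  exact: leqnn.
have cv := @ge0_nondecreasing_set_cvg_integral _ T R (tball (point : T)) g mu.
have {cv}cv : \int[mu]_(x in tball (point : T) i) g x @[i --> \oo] -->
    \int[mu]_(x in \bigcup_i tball (point : T) i) g x.
  apply: cv => //.
  move=> m n mn; apply/subsetPset => y; rewrite /tball /= => ym.
  exact: leq_trans ym mn.
rewrite -(cvg_lim _ cv)//; apply: lime_le; first by apply/cvg_ex; eexists; exact: cv.
apply: nearW => n.
have -> : tball (point : T) n = [set` ballf (point : T) n].
  by rewrite fset_setK//; exact: finite_tball.
by rewrite integral_fset.
Qed.

Lemma counting_le (A : set T) (M : R) :
  (forall X, [set` X] `<=` A -> (#|` X|%:R <= M)%R) -> mu A <= M%:E.
Proof.
move=> H; rewrite /= /counting; case: asboolP => [finA|infA].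
  by rewrite lee_fin; apply: H; rewrite fset_setK.
have [n nM] : exists n : nat, (M < n%:R)%R.
  exists (Num.bound `|M|); apply: le_lt_trans (archi_boundP _) => //.
  exact: ler_norm.
have [X XA nX] := infinite_set_fset n infA.
have := H X XA; rewrite leNgt => /negP[].
by rewrite (lt_le_trans nM)// ler_nat.
Qed.

Lemma counting_ge (A : set T) X : [set` X] `<=` A -> (#|` X|%:R)%:E <= mu A.
Proof.
move=> XA; rewrite /= /counting; case: asboolP => [finA|_]; last exact: leey.
rewrite lee_fin ler_nat fsubset_leq_card// -[X in (X `<=` _)%fset]set_fsetK.
by rewrite -fset_set_sub.
Qed.

Lemma counting_ball (x : T) r : mu (tball x r) = #|` ballf x r|%:R%:E.
Proof. by rewrite /= /counting asboolT//; exact: finite_tball. Qed.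

End TreeIntegrals.

(** * The maximal operator on Lorentz and Lebesgue spaces *)

Section Operators.
Context {R : realType} {T : tree}.
Local Notation mu := (@counting T R).
Hypothesis finite_neighbours : forall x : T, finite_set (neighbours x).
Implicit Types (X G : {fset T}) (f : T -> R).

Lemma ball_term f x r :
  ((mu (tball x r))^-1 * \int[mu]_(y in tball x r) `|f y|%:E)%E =
  ((\sum_(y <- ballf x r) `|f y|) / #|` ballf x r|%:R)%:E.
Proof.
have B0 := @card_ballf_gt0 R T finite_neighbours x r.
rewrite counting_ball// inver gt_eqF//.
have -> : tball x r = [set` ballf x r].
  by rewrite fset_setK//; exact: finite_tball.
by rewrite integral_fset// sumEFin -EFinM mulrC.
Qed.

Lemma maximal_ge0 f x : (0 <= maximal f x)%E.
Proof.
apply: le_ereal_sup_tmp; eexists; first by exists 0%N; [|reflexivity].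
by rewrite ball_term lee_fin divr_ge0// sumr_ge0.
Qed.

Lemma maximal_gtP f x (lam : R) : (lam%:E < maximal f x)%E ->
  exists r, lam * #|` ballf x r|%:R < \sum_(y <- ballf x r) `|f y|.
Proof.
move=> /ereal_sup_gt[_ [r _ <-]]; rewrite ball_term lte_fin => h; exists r.
by rewrite -ltr_pdivlMr// card_ballf_gt0.
Qed.

(** All the balls that witness the values [v x] lie in one finite set [G]. *)
Lemma maximal_gt_radii f X (v : T -> R) :
  (forall x, x \in X -> ((v x)%:E < maximal f x)%E) ->
  exists (r : T -> nat) G, forall x, x \in X ->
    v x * #|` ballf x (r x)|%:R < \sum_(y <- G | (dist x y <= r x)%N) `|f y|.
Proof.
move=> H.
have /choice[r rP] x : exists r, x \in X ->
    v x * #|` ballf x r|%:R < \sum_(y <- ballf x r) `|f y|.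
  have [xX|_] := boolP (x \in X); last by exists 0%N.
  by have [r ?] := maximal_gtP (H x xX); exists r.
exists r, (\bigcup_(x <- X) ballf x (r x))%fset => x xX.
apply: lt_le_trans (rP x xX) _; rewrite -[leRHS]big_filter.
apply: ler_sum_uniq; rewrite ?filter_uniq ?fset_uniq// => y yB.
rewrite mem_filter -in_ballf// yB /=.
by apply/bigfcupP; exists x; rewrite ?xX.
Qed.

Lemma Lorentz_oo_le f (p M : R) : 0 < p -> 0 <= M ->
  (forall (lam : R) X, 0 < lam -> (forall x, x \in X -> (lam%:E < maximal f x)%E) ->
    lam * #|` X|%:R `^ p^-1 <= M) ->
  (Lorentz p +oo (maximal f) <= M%:E)%E.
Proof.
move=> p0 M0 H; apply: ge_ereal_sup => _ [t /= + <-]; rewrite in_itv/= andbT => t0.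
have le_mu : (mu [set x | (t%:E < `|maximal f x|)%E] <= ((M / t) `^ p)%:E)%E.
  apply: counting_le => X XE.
  have := H t X t0; rewrite -ler_pdivlMl// mulrC.
  move=> /(_ _)/wrap[x xX|].
    by have := XE x xX; rewrite /= gee0_abs// maximal_ge0.
  have nn : #|` X|%:R `^ p^-1 \is Num.nneg by rewrite nnegrE powR_ge0.
  have Mt : M / t \is Num.nneg by rewrite nnegrE divr_ge0// ltW.
  move/(ge0_ler_powR (ltW p0) nn Mt).
  by rewrite -powRrM mulVf ?gt_eqF// powRr1.
have le_muV : (mu [set x | (t%:E < `|maximal f x|)%E] `^ p^-1 <= (M / t)%:E)%E.
  have -> : (M / t)%:E = (((M / t) `^ p)%:E `^ p^-1)%E.
    by rewrite poweR_EFin -powRrM divff ?gt_eqF// powRr1// divr_ge0// ltW.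
  apply: gt0_ler_poweR; rewrite ?in_itv/= ?leey ?andbT ?invr_ge0 ?(ltW p0)//.
  by rewrite lee_fin powR_ge0.
have -> : M%:E = (t%:E * (M / t)%:E)%E by rewrite -EFinM mulrC divfK// gt_eqF.
by rewrite lee_wpmul2l// lee_fin ltW.
Qed.

Lemma Lorentz_1_ge f (p c : R) G (w : T -> R) : 0 < p -> 0 < c ->
  (forall y, 0 <= w y) ->
  (forall t : R, 0 < t -> \sum_(y <- G | t < `|f y|) w y <=
     c * #|` [fset y in G | t < `|f y|]%fset|%:R `^ p^-1) ->
  ((p * (\sum_(y <- G) w y * `|f y|) / c)%:E <= Lorentz p 1 (EFin \o f))%E.
Proof.
move=> p0 c0 w0 H; rewrite /Lorentz invr1 poweRe1; last first.
  rewrite mule_ge0 ?lee_fin ?(ltW p0)//; apply: integral_ge0 => t _.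
  by rewrite mule_ge0 ?poweR_ge0// lee_fin powR_ge0.
rewrite -mulrA EFinM lee_wpmul2l ?lee_fin ?(ltW p0)//.
rewrite mulrC mulr_sumr; under eq_bigr do rewrite mulrA.
apply: (@layer_cake_le R _ G (fun y => c^-1 * w y) (fun y => `|f y|)) => // [y|t t0].
  by rewrite mulr_ge0// invr_ge0 ltW.
rewrite subrr powRr0 mule1 mul1r -mulr_sumr.
apply: (@le_trans _ _ (#|` [fset y in G | t < `|f y|]%fset|%:R `^ p^-1)%:E).
  by rewrite lee_fin ler_pdivrMl// H.
rewrite -poweR_EFin; apply: gt0_ler_poweR; rewrite ?in_itv/= ?leey ?andbT ?invr_ge0 ?(ltW p0)//.
apply: counting_ge => y /=; rewrite in_fset_cond => /andP[_].
by rewrite lte_fin.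
Qed.

(** The norm of [L^{1,1}] is that of [L^1], as the layers of [f] show, so the weak type
    (1,1) estimate is already the claim. *)
Lemma restricted_weak_type_1 (K : R) : 0 < K ->
  (forall (lam : R) X G (g : T -> R) (r : T -> nat), 0 < lam -> (forall y, 0 <= g y) ->
    (forall x, x \in X -> lam * #|` ballf x (r x)|%:R <
                          \sum_(y <- G | (dist x y <= r x)%N) g y) ->
    #|` X|%:R <= K * lam^-1 * \sum_(y <- G) g y) ->
  restricted_weak_type (@maximal R T) 1.
Proof.
move=> K0 weak; exists K => // f.
have L0 : (0 <= Lorentz 1 1 (EFin \o f))%E by rewrite /Lorentz poweR_ge0.
move LE : (Lorentz 1 1 (EFin \o f)) L0 => [L| |] //= L0 _.
rewrite lee_fin in L0.
rewrite -EFinM; apply: Lorentz_oo_le => //; first by rewrite mulr_ge0// ltW.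
move=> lam X lam0 H; rewrite invr1 powRr1//.
have [r [G GP]] := maximal_gt_radii H.
have := weak lam X G (fun y => `|f y|) r lam0 (fun y => normr_ge0 _) GP.
move=> /(ler_wpM2l (ltW lam0)); rewrite mulrA (mulrC K) mulrA divff ?gt_eqF// mul1r.
move=> /le_trans; apply.
rewrite ler_wpM2l ?(ltW K0)//.
have := @Lorentz_1_ge f 1 1 G (fun=> 1) ltr01 ltr01 (fun=> ler01).
rewrite LE !mul1r divr1 lee_fin; under eq_bigr do rewrite mul1r.
apply=> t t0; rewrite invr1 powRr1// mul1r -sum1_fset -[leLHS]big_filter.
apply: ler_sum_uniq; rewrite ?filter_uniq ?fset_uniq// => y.
by rewrite mem_filter in_fset_cond andbC.
Qed.

(** With radii [r x] chosen for the points of a finite set [X], the sum over [X] of the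
    averages of [f] is linear in [f], namely [\sum_y w y * `|f y|]. For the indicator
    functions of the superlevel sets of [f] it is at most
    [K * #|E| `^ (1 / p) * #|X| `^ (1 - 1 / p)], and integrating over the level brings
    in the norm of [L^{p,1}]. *)
Lemma restricted_weak_type_gt1 (p : R) : 1 < p -> weak_on_sets T p ->
  restricted_weak_type (@maximal R T) p.
Proof.
move=> p1 /(restricted_bilinear finite_neighbours p1)[K K0 bil].
have p0 : 0 < p by lra.
exists (K / p) => [|f]; first by rewrite divr_gt0.
have L0 : (0 <= Lorentz p 1 (EFin \o f))%E by rewrite /Lorentz poweR_ge0.
move LE : (Lorentz p 1 (EFin \o f)) L0 => [L| |] //= L0 _.
rewrite lee_fin in L0.
have Kp0 : 0 <= K / p by rewrite divr_ge0// ltW.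
rewrite -EFinM; apply: Lorentz_oo_le => //; first by rewrite mulr_ge0.
move=> lam X lam0 H.
have [->|X0] := eqVneq X fset0.
  rewrite cardfs0 powR0; last by rewrite invr_eq0 gt_eqF.
  by rewrite mulr0 (mulr_ge0 Kp0 L0).
have n0 : 0 < #|` X|%:R :> R by rewrite ltr0n cardfs_gt0.
have [r [G GP]] := maximal_gt_radii H.
have B0 x : 0 < #|` ballf x (r x)|%:R :> R by exact: card_ballf_gt0.
(* The weight of y in the sum over X of the averages over the balls. *)
pose w y : R := \sum_(x <- X | (dist x y <= r x)%N) #|` ballf x (r x)|%:R^-1.
pose c : R := K * #|` X|%:R `^ (1 - p^-1).
have c0 : 0 < c by rewrite mulr_gt0// powR_gt0.
have sum_w (P : pred T) (g : T -> R) : \sum_(y <- G | P y) w y * g y =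
    \sum_(x <- X) (\sum_(y <- G | P y && (dist x y <= r x)%N) g y) / #|` ballf x (r x)|%:R.
  rewrite /w; under eq_bigr do rewrite mulr_suml.
  rewrite (exchange_big_dep xpredT) //=; apply: eq_bigr => x _.
  by rewrite mulr_suml; apply: eq_bigr => y _; rewrite mulrC.
have w0 y : 0 <= w y by rewrite sumr_ge0// => x _; rewrite invr_ge0.
have w_le (t : R) : 0 < t -> \sum_(y <- G | t < `|f y|) w y <=
    c * #|` [fset y in G | t < `|f y|]%fset|%:R `^ p^-1.
  move=> t0; under eq_bigr do rewrite -[w _]mulr1.
  rewrite (sum_w (fun y => t < `|f y|) (fun=> 1)) /c mulrAC.
  apply: le_trans (bil X [fset y in G | t < `|f y|]%fset r).
  apply: ler_sum => x _; rewrite ler_pM2r ?invr_gt0//.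
  rewrite -big_filter -[leRHS]big_filter.
  apply: ler_sum_uniq; rewrite ?filter_uniq ?fset_uniq// => y.
  by rewrite !mem_filter in_fset_cond => /andP[/andP[-> ->] ->].
have := Lorentz_1_ge p0 c0 w0 w_le.
rewrite LE lee_fin (sum_w xpredT (fun y => `|f y|)) /= => le_L.
have le_lam : lam * #|` X|%:R <= \sum_(x <- X)
    (\sum_(y <- G | (dist x y <= r x)%N) `|f y|) / #|` ballf x (r x)|%:R.
  rewrite -sum1_fset mulr_sumr mulr1 big_seq [leRHS]big_seq; apply: ler_sum => x xX.
  by rewrite ler_pdivlMr// ltW// GP.
have {le_L le_lam} : p * (lam * #|` X|%:R) / c <= L.
  apply: le_trans le_L; rewrite ler_pM2r ?invr_gt0// ler_pM2l//.
have -> : p * (lam * #|` X|%:R) / c = p / K * (lam * #|` X|%:R `^ p^-1).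
  have -> : #|` X|%:R `^ p^-1 = #|` X|%:R / #|` X|%:R `^ (1 - p^-1) :> R.
    rewrite -[X in X / _](powRr1 (ltW n0)) -powRB; last by rewrite (gt_eqF n0) implybT.
    by have -> : 1 - (1 - p^-1) = p^-1 by ring.
  by rewrite /c; field; rewrite !gt_eqF// powR_gt0.
by rewrite -ler_pdivlMl ?divr_gt0// invf_div.
Qed.

(** Only the empty set has counting measure zero. *)
Lemma counting_ae (P : T -> Prop) : (\forall x \ae mu, P x) -> forall x, P x.
Proof.
move=> [A [_ A0 PA]] x; apply: contrapT => nPx.
have Ax : [set` [fset x]%fset] `<=` A.
  by move=> y /=; rewrite inE => /eqP ->; exact: PA.
have := @counting_ge R T A [fset x]%fset Ax.
by rewrite A0 cardfs1 lee_fin ler10.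
Qed.

Lemma bounded_on_Loo : bounded_on_L (@maximal R T) +oo.
Proof.
exists 1 => // f; rewrite mul1e unlock.
case: ifPn => // _ Noo.
have fN x := counting_ae (ess_sup_ge mu (abse \o (EFin \o f))) x.
set N := ess_sup _ _ in Noo fN *.
have N0 : (0 <= N)%E by apply: le_trans (fN point); rewrite /= lee_fin.
case: N N0 Noo fN => [N| |] //= N0 _ fN.
apply/ess_supP; apply: aeW => x /=.
rewrite gee0_abs ?maximal_ge0//; apply: ge_ereal_sup => _ [r _ <-].
rewrite ball_term lee_fin ler_pdivrMr ?card_ballf_gt0//.
rewrite mulrC -sum1_fset mulr_suml; apply: ler_sum => y _.
by rewrite mul1r -lee_fin.
Qed.

(** The values [v x = maximal f x / 2] lie strictly below the supremum, hence are exceeded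
    by an average, at the price of a factor 2. This presupposes that [maximal f x] is
    finite, which the same estimate shows for a single point. *)
Lemma bounded_on_Lp (p0 p : R) : 0 < p0 -> p0 < p -> weak_on_sets T p0 ->
  bounded_on_L (@maximal R T) p%:E.
Proof.
move=> p00 p0p /(strong_of_weak_on_sets finite_neighbours p00 p0p)[K K0 strong].
have pp : 0 < p by lra.
exists (2 * K `^ p^-1) => [|f]; first by rewrite mulr_gt0 ?powR_gt0.
rewrite unlock.
have I0 : (0 <= \int[mu]_y `|(EFin \o f) y| `^ p)%E.
  by apply: integral_ge0 => y _; exact: poweR_ge0.
move IE : (\int[mu]_y `|(EFin \o f) y| `^ p)%E I0 => [I| |] //= I0; first last.
  by rewrite invr_eq0 (gt_eqF pp) ltxx.
move=> _; rewrite lee_fin in I0.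
have key X (v : T -> R) : (forall x, x \in X -> 0 < v x /\ ((v x)%:E < maximal f x)%E) ->
    \sum_(x <- X) v x `^ p <= K * I.
  move=> vP; have [r [G GP]] := maximal_gt_radii (fun x xX => (vP x xX).2).
  have := strong X G (fun y => `|f y|) r v (fun y => normr_ge0 _).
  move=> /(_ (fun x xX => conj (vP x xX).1 (GP x xX)))/le_trans; apply.
  rewrite ler_wpM2l ?(ltW K0)//.
  have := @sum_le_integral R T G (fun y => `|(EFin \o f) y| `^ p)%E.
  rewrite IE => /(_ (fun y => poweR_ge0 _ _)) /=.
  by rewrite sumEFin lee_fin.
have KI0 : 0 <= K * I by rewrite mulr_ge0// ltW.
have fin x : maximal f x \is a fin_num.
  rewrite ge0_fin_numE ?maximal_ge0// ltey; apply/eqP => Mx.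
  pose v := (K * I + 1) `^ p^-1.
  have v0 : 0 < v by rewrite powR_gt0; lra.
  have := key [fset x]%fset (fun=> v).
  rewrite big_seq_fset1 /v -powRrM mulVf ?gt_eqF// powRr1; last lra.
  move=> /(_ _)/wrap[y|]; last by lra.
  by rewrite inE => /eqP ->; rewrite Mx ltey; split => //; rewrite powR_gt0; lra.
have main : (\int[mu]_x `|maximal f x| `^ p <= (2 `^ p * (K * I))%:E)%E.
  apply: integral_le_of_sums => // [x|X]; first exact: poweR_ge0.
  pose m x := fine (maximal f x).
  have mE x : maximal f x = (m x)%:E by rewrite /m fineK.
  have m0 x : 0 <= m x by rewrite -lee_fin -mE maximal_ge0.
  under eq_bigr do rewrite mE /= ger0_norm//.
  rewrite sumEFin lee_fin.
  pose X' := [fset x in X | 0 < m x]%fset.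
  have := key X' (fun x => m x / 2).
  move=> /(_ _)/wrap[x|].
    rewrite in_fset_cond mE lte_fin => /andP[_ mx]; split; first by rewrite divr_gt0.
    by lra.
  have -> : \sum_(x <- X') (m x / 2) `^ p = 2^-1 `^ p * \sum_(x <- X) m x `^ p.
    rewrite (eq_bigr (fun x => 2^-1 `^ p * m x `^ p)); last first.
      by move=> x _; rewrite powRM// mulrC.
    rewrite -mulr_sumr; congr (_ * _).
    rewrite [RHS](bigID (fun x => 0 < m x)) /= [X in _ + X]big1 ?addr0; last first.
      move=> x; rewrite -leNgt => mx0.
      have -> : m x = 0 by apply/eqP; rewrite eq_le mx0 m0.
      by rewrite powR0// gt_eqF.
    rewrite -[RHS]big_filter; apply: perm_big; apply: uniq_perm.
    - exact: fset_uniq.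
    - by rewrite filter_uniq ?fset_uniq.
    - by move=> x; rewrite mem_filter in_fset_cond andbC.
  rewrite -powR_inv1// powRAC powR_inv1 ?powR_ge0//.
  by rewrite ler_pdivrMl ?powR_gt0.
apply: (@le_trans _ _ ((2 `^ p * (K * I))%:E `^ p^-1)%E).
  apply: gt0_ler_poweR; rewrite ?in_itv/= ?leey ?andbT ?invr_ge0 ?(ltW pp)//.
  - by apply: integral_ge0 => x _; exact: poweR_ge0.
  - by rewrite lee_fin mulr_ge0 ?powR_ge0.
rewrite !poweR_EFin -EFinM lee_fin.
rewrite !powRM ?powR_ge0 ?(ltW K0)// -powRrM divff ?gt_eqF// powRr1//.
by rewrite mulrA.
Qed.

End Operators.

(** * The theorem *)

Lemma powR_log (R : realType) (c x : R) : 1 < c -> 0 < x -> c `^ (log c x) = x.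
Proof.
move=> c1 x0; have lc : ln c != 0 by rewrite gt_eqF// ln_gt0.
rewrite /log /powR gt_eqF ?divfK ?lnK//; lra.
Qed.

(** The case [alpha = b] stands apart: there [beta = 1], and the antidiagonals with
    [m <= m1] would cost a factor of order [ln (1 / lam)]; nor is weak [L^1] normable, so
    that an estimate for sets would not extend to functions. *)
Lemma maximal_bounds (R : realType) (T : tree) (b : nat) (alpha C : R) :
  (1 < b)%N -> (forall x : T, finite_set (neighbours x)) ->
  (forall x : T, (nu x <= b.+1)%N) -> 0 < alpha -> 0 < C ->
  (forall (x : T) (r : nat), ((C * alpha ^+ r)%:E <= counting (tball x r))%E) ->
  b%:R <= alpha ^+ 2 ->
  restricted_weak_type (@maximal R T) (log alpha b%:R) /\
  forall p : \bar R, ((log alpha b%:R)%:E < p)%E -> bounded_on_L (@maximal R T) p.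
Proof.
move=> b1 fin nu_le a0 C0 growth b_le.
have b2 : 2 <= b%:R :> R by rewrite ler_nat.
have a1 : 1 < alpha.
  rewrite ltNge; apply/negP => ale1.
  have : alpha ^+ 2 <= 1 by rewrite expr_le1// ltW.
  lra.
have ball_ge (x : T) r : C * alpha ^+ r <= #|` ballf x r|%:R.
  by have := growth x r; rewrite counting_ball.
have alpha_b := alpha_le_b fin nu_le b1 C0 a1 ball_ge.
suff [weak restr] : weak_on_sets T (log alpha b%:R) /\
    restricted_weak_type (@maximal R T) (log alpha b%:R).
  split=> // -[p| |] // p0p; last exact: bounded_on_Loo.
  apply: bounded_on_Lp weak => //.
  by rewrite divr_gt0 ?ln_gt0//; lra.
move: alpha_b; rewrite le_eqVlt => /orP[/eqP ab|ltab].
  have -> : log alpha b%:R = 1 by rewrite /log -ab divff// gt_eqF// ln_gt0.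
  split; first exact: weak_on_sets_1 fin nu_le b1 C0 a1 ball_ge ab.
  have [K K0 weak] := weak_type_11_balls fin nu_le b1 C0 a1 ball_ge ab.
  exact: restricted_weak_type_1 weak.
have p1 : 1 < log alpha b%:R.
  by rewrite /log ltr_pdivlMr ?ln_gt0// mul1r ltr_ln ?posrE//; lra.
have ap : alpha `^ log alpha b%:R = b%:R by rewrite powR_log//; lra.
have weak := weak_on_sets_gt1 fin nu_le b1 C0 a1 ball_ge p1 ap b_le.
by split=> //; exact: restricted_weak_type_gt1.
Qed.

Theorem theorem3p2 (R : realType) (T : tree) (a b : nat)
    (ha : (2 <= a)%N) (hab : (a <= b)%N) (hT : Upsilon T a b) :
  ((b <= a ^ 2)%N ->
     let tau := log (a%:R : R) b%:R in
     restricted_weak_type (@maximal R T) tau /\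
     forall p : \bar R, (tau%:E < p)%E -> bounded_on_L (@maximal R T) p)
  /\
  (forall alpha C : R, 0 < alpha -> 0 < C ->
     (forall (x : T) (r : nat),
        ((C * alpha ^+ r)%:E <= counting (tball x r))%E) ->
     b%:R <= alpha ^+ 2 ->
     let p_ab := log alpha b%:R in
     restricted_weak_type (@maximal R T) p_ab /\
     forall p : \bar R, (p_ab%:E < p)%E -> bounded_on_L (@maximal R T) p).
Proof.
have [nu_ab _ _] := hT.
have fin x : finite_set (neighbours x) := (nu_ab x).1.
have nu_le (x : T) : (nu x <= b.+1)%N by have [_ /andP[]] := nu_ab x.
have nu_ge (x : T) : (a.+1 <= nu x)%N by have [_ /andP[]] := nu_ab x.
have b1 : (1 < b)%N := leq_trans ha hab.
split=> [ba2 /=|alpha C a0 C0 growth b_le /=]; last first.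
  exact: maximal_bounds b1 fin nu_le a0 C0 growth b_le.
apply: (@maximal_bounds R T b a%:R 1) => //.
- by rewrite ltr0n ltnW.
- move=> x r; rewrite counting_ball// lee_fin mul1r -natrX ler_nat.
  apply: leq_trans (card_sphere_ge fin x r nu_ge) _.
  by rewrite card_ballf// big_ord_recr leq_addl.
- by rewrite -natrX ler_nat.
Qed.
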